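(* Let $\mathbb{F}$ be a field of characteristic $p\ge 2$. Suppose $f\in\mathbb{F}[x_1,\ldots,x_n]$ has degree $\mathrm{poly}(n)$, is computed by an algebraic formula (respectively algebraic branching program) of size $n^{O(\log n)}$, and factors into irreducibles as $f = \prod_i f_i^{p^{e_i} j_i}$ with $p\nmid j_i$. Let $\lambda := \#\{e_i\}$ be the number of distinct values among the $e_i$. Then for each $i$, $f_i^{p^{e_i}}$ can be computed by an algebraic formula (respectively algebraic branching program) over $\overline{\mathbb{F}}_p$ of size $\mathrm{poly}(n^{\lambda\log n})$.
   Context: An algebraic formula is an algebraic circuit (DAG of $+,\times$ gates with variables and field constants at leaves) whose underlying graph is a tree; size is the number of nodes and edges. An algebraic branching program is a layered directed graph with unique source and sink, edges between consecutive layers labelled by affine linear polynomials, computing the sum over source–sink paths of the product of edge labels; size is the number of edges. $\overline{\mathbb{F}}_p$ denotes the algebraic closure of the prime field of characteristic $p$.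
   Formalization: The field F is assumed to embed in the algebraic closure of F_p (so F is algebraic over F_p); without this the claim fails, e.g. f = x_1 + t over F_p(t) is irreducible but has a coefficient outside that closure. *)

(* Defs.v *)
From HB Require Import structures.
From mathcomp Require Import all_boot all_order all_algebra all_field.
From mathcomp Require Import mpoly.

Set Implicit Arguments.
Unset Strict Implicit.
Unset Printing Implicit Defensive.

Import GRing.Theory.
Local Open Scope ring_scope.

(* Gates have unbounded fan-in. A gate without children computes 0 (sum) or
   1 (product) with size 1, exactly as the corresponding constant leaf does. *)
Inductive formula (R : Type) (n : nat) : Type :=
| FVar of 'I_n
| FConst of R
| FAdd of seq (formula R n)
| FMul of seq (formula R n).

Fixpoint formula_eval (R : comNzRingType) (n : nat) (t : formula R n) :
    {mpoly R[n]} :=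
  match t with
  | FVar i => 'X_i
  | FConst c => c%:MP
  | FAdd ts => foldr +%R 0 (map (@formula_eval R n) ts)
  | FMul ts => foldr *%R 1 (map (@formula_eval R n) ts)
  end.

(* Number of nodes plus number of edges: a gate contributes 1 for itself and 1
   for the edge to each of its children. *)
Fixpoint formula_size (R : Type) (n : nat) (t : formula R n) : nat :=
  match t with
  | FVar _ | FConst _ => 1%N
  | FAdd ts | FMul ts =>
      (1 + size ts + sumn (map (@formula_size R n) ts))%N
  end.

(* The layers are numbered 0, ..., abp_depth. The source is the only vertex of
   the first layer and the sink the only vertex of the last one. Labels of
   pairs that are not edges are never used. *)
Record abp (R : comNzRingType) (n : nat) := Abp {
  abp_vertex : finType;
  abp_depth : nat;
  abp_layer : abp_vertex -> nat;
  abp_source : abp_vertex;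
  abp_sink : abp_vertex;
  abp_edge : rel abp_vertex;
  abp_label : abp_vertex -> abp_vertex -> {mpoly R[n]};
  abp_layer_le : forall v, (abp_layer v <= abp_depth)%N;
  abp_sourceP : forall v, abp_layer v = 0%N <-> v = abp_source;
  abp_sinkP : forall v, abp_layer v = abp_depth <-> v = abp_sink;
  abp_edge_layer : forall u v, abp_edge u v -> abp_layer v = (abp_layer u).+1;
  (* msize is the total degree plus one *)
  abp_label_affine : forall u v, abp_edge u v -> (msize (abp_label u v) <= 2)%N
}.

(* By the layering every source-sink path has exactly abp_depth edges; such a
   path is given by the vertices that follow the source. *)
Definition abp_eval (R : comNzRingType) (n : nat) (B : abp R n) :
    {mpoly R[n]} :=
  \sum_(q : (abp_depth B).-tuple (abp_vertex B)
          | path (@abp_edge _ _ B) (abp_source B) q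
            && (last (abp_source B) q == abp_sink B))
    \prod_(a <- pairmap (@abp_label _ _ B) (abp_source B) q) a.

Definition abp_size (R : comNzRingType) (n : nat) (B : abp R n) : nat :=
  #|[set e : abp_vertex B * abp_vertex B | abp_edge e.1 e.2]|.

Definition formula_computable (R : comNzRingType) (n : nat)
    (f : {mpoly R[n]}) (s : nat) : Prop :=
  exists t : formula R n, formula_eval t = f /\ (formula_size t <= s)%N.

Definition abp_computable (R : comNzRingType) (n : nat)
    (f : {mpoly R[n]}) (s : nat) : Prop :=
  exists B : abp R n, abp_eval B = f /\ (abp_size B <= s)%N.

Definition irreducible_elt (R : unitRingType) (x : R) : Prop :=
  [/\ x != 0, x \isn't a GRing.unit &
      forall a b : R, x = a * b ->
        a \is a GRing.unit \/ b \is a GRing.unit].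

Definition associated (R : unitRingType) (x y : R) : Prop :=
  exists2 u : R, u \is a GRing.unit & x = u * y.

(* f = u * \prod_i f_i ^ (p ^ e_i * j_i), with u a nonzero constant and the f_i
   pairwise non-associated irreducibles. *)
Definition irreducible_factorization (F : fieldType) (p n r : nat)
    (f : {mpoly F[n]}) (fs : 'I_r -> {mpoly F[n]}) (e j : 'I_r -> nat) : Prop :=
  [/\ forall i, irreducible_elt (fs i),
      forall i k, associated (fs i) (fs k) -> i = k,
      forall i, ~~ (p %| j i)%N &
      exists2 u : F, u != 0 &
        f = u%:MP * \prod_(i < r) fs i ^+ (p ^ e i * j i)].

Definition num_values (r : nat) (e : 'I_r -> nat) : nat :=
  size (undup (codom e)).

(* K is an algebraic closure of its prime field 'F_p, embedded by phi *)
Definition prime_field_closure (p : nat) (K : closedFieldType)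
    (phi : {rmorphism 'F_p -> K}) : Prop :=
  forall x : K, algebraicOver phi x.

(* The binary logarithm, rounded up *)
Definition log2n (n : nat) : nat := up_log 2 n.

(* Main.v *)
Require Import Defs.
From HB Require Import structures.
From mathcomp Require Import all_boot all_order all_algebra all_field.
From mathcomp Require Import mpoly ring zify.
From Stdlib Require Import Classical_Prop.

Set Implicit Arguments.
Unset Strict Implicit.
Unset Printing Implicit Defensive.

Import GRing.Theory.
Local Open Scope ring_scope.

(* Since F embeds in an algebraic closure of its prime field it is perfect, so
   each f_i has a nonzero partial derivative. Unique factorization in
   F[x, b][y] then shows that on a generic line x + y b the polynomials f_i
   restrict to univariate polynomials of full degree with simple roots and
   without common roots; these properties survive at a suitable point (x, b)
   over the infinite field K.

   Recentred on such a line, g(x + y b) splits as a product of y - phi_a, with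
   one power series phi_a in x for each root a on the line, so that g is the
   truncation of a constant times the product of the - phi_a. If C = g^m R with
   p not dividing m, then phi_a is a simple root of the Hasse derivative of
   order m - 1 of C(x + y b) in y, so Newton's iteration reaches the required
   precision after O(log D) steps, where D bounds the degree; each step
   multiplies the size by poly(D).

   For general exponents one proceeds by increasing e_i: dividing f by the
   powers already found (a truncated geometric series) leaves a polynomial
   C(x^q) with q = p^(e_i), and the previous argument applies to C with the
   cost of a polynomial h redefined as the cost of h(x^q). This yields
   f_i^q = g(x^q), where g is f_i with its coefficients raised to the power q,
   at the price of one factor D^(O(log D)) for each distinct value of e. *)

(** * Unique factorization domains *)

Definition divides (R : comNzRingType) (a b : R) : Prop := exists c, b = c * a.

Definition prime_elt (R : comNzRingType) (x : R) : Prop :=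
  forall a b, divides x (a * b) -> divides x a \/ divides x b.

Section Divides.
Variable R : comNzRingType.
Implicit Types a b c : R.

Lemma divides0 a : divides a 0.
Proof. by exists 0; rewrite mul0r. Qed.

Lemma divides_mull a b c : divides a b -> divides a (c * b).
Proof. by move=> [u ->]; exists (c * u); rewrite mulrA. Qed.

Lemma divides_mulr a b c : divides a b -> divides a (b * c).
Proof. by rewrite mulrC; apply: divides_mull. Qed.

Lemma divides_multiple a c : divides a (c * a).
Proof. by exists c. Qed.

Lemma dividesD a b c : divides a b -> divides a c -> divides a (b + c).
Proof. by move=> [u ->] [v ->]; exists (u + v); rewrite mulrDl. Qed.

Lemma dividesB a b c : divides a b -> divides a c -> divides a (b - c).
Proof. by move=> [u ->] [v ->]; exists (u - v); rewrite mulrBl. Qed.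

Lemma divides_trans b a c : divides a b -> divides b c -> divides a c.
Proof. by move=> [u ->] [v ->]; exists (v * u); rewrite mulrA. Qed.

End Divides.

Lemma divides_rmorph (R S : comNzRingType) (phi : {rmorphism R -> S}) a b :
  divides a b -> divides (phi a) (phi b).
Proof. by move=> [c ->]; exists (phi c); rewrite rmorphM. Qed.

Section Isomorphism.
Variables (A B : unitRingType) (phi : {rmorphism A -> B}) (psi : {rmorphism B -> A}).
Hypotheses (phiK : cancel phi psi) (psiK : cancel psi phi).

Lemma unit_iso a : (phi a \is a GRing.unit) = (a \is a GRing.unit).
Proof.
by apply/idP/idP => [/(rmorph_unit psi)|/(rmorph_unit phi)//]; rewrite /= phiK.
Qed.

Lemma irreducible_iso a : irreducible_elt a -> irreducible_elt (phi a).
Proof.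
move=> [nza nua irra]; split=> [||b c def_a].
- by rewrite -(rmorph0 phi) (inj_eq (can_inj phiK)).
- by rewrite unit_iso.
- by rewrite -[b]psiK -[c]psiK !unit_iso; apply: irra; rewrite -rmorphM -def_a phiK.
Qed.

End Isomorphism.

Definition length_function (R : idomainType) (mu : R -> nat) : Prop :=
  (forall a b, a != 0 -> b != 0 -> mu (a * b) = (mu a + mu b)%N) /\
  (forall a, a != 0 -> mu a = 0%N -> a \is a GRing.unit).

(* Factorizations into irreducibles exist because a length function bounds
   the number of factors. *)
Record ufd (R : idomainType) : Prop := Ufd {
  ufd_length : exists mu : R -> nat, length_function mu;
  ufd_prime : forall x : R, irreducible_elt x -> prime_elt x
}.

Lemma length_ltMr (R : idomainType) (mu : R -> nat) a b :
  length_function mu -> a * b != 0 -> b \isn't a GRing.unit -> (mu a < mu (a * b)%R)%N.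
Proof.
move=> [muM mu_eq0]; rewrite mulf_eq0 => /norP[nza nzb] nub.
rewrite muM // -[ltnLHS]addn0 ltn_add2l lt0n.
by apply: contraNneq nub => /(mu_eq0 _ nzb).
Qed.

Section UfdTheory.
Variable R : idomainType.
Hypothesis ufdR : ufd R.

Lemma irreducible_divisor (a : R) : a != 0 -> a \isn't a GRing.unit ->
  exists2 x, irreducible_elt x & divides x a.
Proof.
have [mu mu_length] := ufd_length ufdR.
have [k] := ubnP (mu a); elim: k a => // k IH a lek nza nua.
have [irra|reda] := classic (irreducible_elt a).
  by exists a; rewrite // -[X in divides _ X]mul1r; apply: divides_multiple.
have [b [c [def_a nub nuc]]] : exists b c,
    [/\ a = b * c, b \isn't a GRing.unit & c \isn't a GRing.unit].
  apply: NNPP => no_bc; apply: reda; split=> // b c def_a.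
  have [ub|nub] := boolP (b \is a GRing.unit); first by left.
  have [uc|nuc] := boolP (c \is a GRing.unit); first by right.
  by case: no_bc; exists b, c.
have [||x irrx div_xb] := IH b _ _ nub.
- by rewrite -ltnS (leq_trans _ lek) // ltnS def_a length_ltMr // -def_a.
- by apply: contraNneq nza => b0; rewrite def_a b0 mul0r.
- by exists x; rewrite // def_a; apply: divides_mulr.
Qed.

Lemma ufd_ind (P : R -> Prop) :
  (forall a, a \is a GRing.unit -> P a) ->
  (forall x a, irreducible_elt x -> a != 0 -> P a -> P (a * x)) ->
  forall a, a != 0 -> P a.
Proof.
have [mu mu_length] := ufd_length ufdR => Punit Pmul a.
have [k] := ubnP (mu a); elim: k a => // k IH a lek nza.
have [/Punit//|nua] := boolP (a \is a GRing.unit).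
have [x irrx [b def_a]] := irreducible_divisor nza nua.
have [_ nux _] := irrx; rewrite def_a; apply: (Pmul) => //.
  by apply: contraNneq nza => b0; rewrite def_a b0 mul0r.
apply: IH; last by apply: contraNneq nza => b0; rewrite def_a b0 mul0r.
by rewrite -ltnS (leq_trans _ lek) // ltnS def_a length_ltMr // -def_a.
Qed.

End UfdTheory.

Lemma ufd_iso (A B : idomainType) (phi : {rmorphism A -> B}) (psi : {rmorphism B -> A}) :
  cancel phi psi -> cancel psi phi -> ufd A -> ufd B.
Proof.
move=> phiK psiK [[mu [muM mu_eq0]] primeA]; split.
  have nz_psi b : (psi b != 0) = (b != 0).
    by rewrite -(inj_eq (can_inj psiK)) rmorph0.
  exists (mu \o psi); split=> [a b nza nzb|a nza] /=.
    by rewrite rmorphM muM ?nz_psi.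
  by move=> /mu_eq0; rewrite nz_psi (unit_iso psiK); apply.
move=> x irrx a b /(divides_rmorph psi); rewrite rmorphM.
have prime_psi := primeA _ (irreducible_iso psiK phiK irrx).
by case/prime_psi => /(divides_rmorph phi); rewrite !psiK; [left|right].
Qed.

Lemma field_ufd (F : fieldType) : ufd F.
Proof.
split; first by exists (fun=> 0%N); split=> // a nza _; rewrite unitfE.
by move=> x [nzx]; rewrite unitfE nzx.
Qed.

(** * Gauss's lemma *)

Section PolyConstants.
Variable R : idomainType.
Implicit Types (f g : {poly R}) (x : R).

Lemma polyC_unit x : (x%:P \is a GRing.unit) = (x \is a GRing.unit).
Proof.
rewrite poly_unitE coefC eqxx size_polyC.
by have [->|] := eqVneq x 0; rewrite ?unitr0 ?andbF.
Qed.

Lemma irreducible_polyC x : irreducible_elt x%:P <-> irreducible_elt x.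
Proof.
split=> [] [nzx nux irrx].
  split=> [||a b def_x]; rewrite -?polyC_unit -?(polyC_eq0 x) //.
  by have [|ua|ub] := irrx a%:P b%:P;
    rewrite -?polyCM ?def_x -?polyC_unit; [|left|right].
split=> [||f g def_x]; rewrite ?polyC_unit ?polyC_eq0 //.
have : size (f * g) == 1%N by rewrite -def_x size_polyC nzx.
rewrite size_mul_eq1 => /andP[szf szg].
have := def_x; rewrite [f]size1_polyC ?(eqP szf) // [g]size1_polyC ?(eqP szg) //.
by rewrite -polyCM !polyC_unit => /polyC_inj; apply: irrx.
Qed.

Lemma dividesC_mulX x g : divides x%:P (g * 'X) -> divides x%:P g.
Proof.
move=> [u def_gX]; exists (drop_poly 1 u); apply/polyP => i.
by rewrite coefMC coef_drop_poly addn1 -coefMC -def_gX coefMX.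
Qed.

Lemma dividesC_drop_poly x f g : divides x f`_0 -> divides x%:P (f * g) ->
  divides x%:P (drop_poly 1 f * g).
Proof.
move=> [c def_f0] div_fg; apply: dividesC_mulX.
have -> : drop_poly 1 f * g * 'X = f * g - (c * x)%:P * g.
  rewrite -def_f0 -{2}(poly_take_drop 1 f) /take_poly poly_def big_ord1 expr0 alg_polyC.
  by ring.
by apply: dividesB => //; apply: divides_mulr; rewrite polyCM; apply: divides_multiple.
Qed.

Lemma dividesC_coef0_drop x f :
  divides x f`_0 -> divides x%:P (drop_poly 1 f) -> divides x%:P f.
Proof.
move=> [c def_f0] div_f; rewrite -(poly_take_drop 1 f).
apply: dividesD; last exact: divides_mulr.
rewrite /take_poly poly_def big_ord1 expr0 alg_polyC def_f0 polyCM.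
exact: divides_multiple.
Qed.

Lemma prime_polyC x : prime_elt x -> prime_elt x%:P.
Proof.
move=> prime_x f g; have [k] := ubnP (size f + size g).
elim: k f g => // k IH f g lek div_fg.
have [->|nzf] := eqVneq f 0; first by left; apply: divides0.
have [->|nzg] := eqVneq g 0; first by right; apply: divides0.
have : divides x (f`_0 * g`_0).
  have [u /(congr1 (fun h : {poly R} => h`_0))] := div_fg.
  by rewrite !coef0M coefC => ->; apply: divides_multiple.
have sz_drop h : h != 0 -> (size (drop_poly 1 h) < size h)%N.
  by rewrite size_drop_poly -size_poly_gt0; case: (size h) => // l; rewrite subn1.
case/prime_x => [div_f0|div_g0].
  have [|div_f|] := IH (drop_poly 1 f) g _ (dividesC_drop_poly div_f0 div_fg).
  - by rewrite -ltnS (leq_trans _ lek) // ltnS ltn_add2r sz_drop.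
  - by left; apply: dividesC_coef0_drop.
  - by right.
have [|| |div_g] := IH f (drop_poly 1 g).
- by rewrite -ltnS (leq_trans _ lek) // ltnS ltn_add2l sz_drop.
- by rewrite mulrC; apply: dividesC_drop_poly => //; rewrite mulrC.
- by left.
- by right; apply: dividesC_coef0_drop.
Qed.

End PolyConstants.

Section PolyUfd.
Variable R : idomainType.
Hypothesis ufdR : ufd R.
Implicit Types (f g h : {poly R}) (x c : R).

Definition primitive f : Prop := forall x, irreducible_elt x -> ~ divides x%:P f.

Lemma primitive_divides f c g : primitive f -> c != 0 ->
  divides f (c%:P * g) -> divides f g.
Proof.
move=> prim_f nzc; move: c nzc g.
apply: (ufd_ind ufdR) => [a ua g div_ag|x a irrx nza IH g].
  by rewrite -[g]mul1r -polyC1 -(mulVr ua) polyCM -mulrA; apply: divides_mull.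
rewrite polyCM -mulrA => div_axg; have {div_axg} [u def_xg] := IH _ div_axg.
have [|[v def_u]|/(prim_f _ irrx)//] := prime_polyC (ufd_prime ufdR irrx) (a := u) (b := f).
  by rewrite -def_xg mulrC; apply: divides_multiple.
exists v; have nzx : x%:P != 0 by rewrite polyC_eq0; case: irrx.
by apply: (mulfI nzx); rewrite def_xg def_u mulrAC mulrC.
Qed.

Lemma primitive_part f : f != 0 ->
  exists c g, [/\ c != 0, primitive g & f = c%:P * g].
Proof.
have [mu mu_length] := ufd_length ufdR.
have [k] := ubnP (mu (lead_coef f)); elim: k f => // k IH f lek nzf.
have [prim_f|not_prim] := classic (primitive f).
  by exists 1, f; rewrite oner_eq0 mul1r.
have [x [irrx [g def_f]]] : exists x, irreducible_elt x /\ divides x%:P f.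
  apply: NNPP => no_x; apply: not_prim => x irrx div_x.
  by apply: no_x; exists x.
have [nzx nux _] := irrx.
have nzg : g != 0 by apply: contraNneq nzf => g0; rewrite def_f g0 mul0r.
have [||c [h [nzc prim_h def_g]]] := IH g => //.
  rewrite -ltnS (leq_trans _ lek) // ltnS def_f lead_coefM lead_coefC.
  by rewrite length_ltMr // mulf_neq0 // lead_coef_eq0.
by exists (x * c), h; rewrite mulf_neq0 // def_f def_g polyCM mulrC mulrA.
Qed.

Lemma irreducible_primitive f : irreducible_elt f -> (1 < size f)%N -> primitive f.
Proof.
move=> [nzf nuf irrf] szf x [nzx nux _] [u def_f].
have [uu|] := irrf _ _ def_f; last by rewrite polyC_unit (negPf nux).
move: uu szf; rewrite def_f poly_unitE mulrC mul_polyC size_scale //.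
by case/andP=> /eqP->.
Qed.

Lemma primitive_dvdp f g : primitive f -> f %| g -> divides f g.
Proof.
move=> prim_f /Pdiv.Idomain.dvdpP[[c q] /= nzc def_g].
by apply: (primitive_divides prim_f nzc); rewrite mul_polyC def_g; apply: divides_multiple.
Qed.

Lemma irreducible_coprimep f g : irreducible_elt f -> (1 < size f)%N ->
  ~ divides f g -> coprimep f g.
Proof.
move=> irrf szf ndiv; have [nzf _ factor_f] := irrf.
have nz_gcd : gcdp f g != 0 by rewrite gcdp_eq0 negb_and nzf.
have [c [d [nzc prim_d def_gcd]]] := primitive_part nz_gcd.
have gcd_d : gcdp f g %= d by rewrite def_gcd mul_polyC eqp_scale.
have [||w def_f] := @primitive_dvdp d f => //.
  by rewrite -(eqp_dvdl _ gcd_d) dvdp_gcdl.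
have [uw|ud] := factor_f _ _ def_f; last first.
  by rewrite /coprimep (eqp_size gcd_d); move: ud; rewrite poly_unitE => /andP[].
case: ndiv; apply: (@divides_trans _ d).
  by exists w^-1; rewrite def_f mulKr.
by apply: primitive_dvdp => //; rewrite -(eqp_dvdl _ gcd_d) dvdp_gcdr.
Qed.

Lemma irreducible_bezout f g : irreducible_elt f -> (1 < size f)%N -> ~ divides f g ->
  exists c u v, c != 0 /\ c%:P = u * f + v * g.
Proof.
move=> irrf szf ndiv; have [szg|szg] := leqP (size g) 1.
  have nzg : g != 0 by apply: contra_notN ndiv => /eqP->; apply: divides0.
  exists g`_0, 0, 1; rewrite mul0r mul1r add0r -size1_polyC //; split=> //.
  by apply: contraNneq nzg => g0; rewrite (size1_polyC szg) g0.
have [[u v] /= _ def_res] := resultant_in_ideal szf szg.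
exists (resultant f g), u, v; split=> //.
by rewrite resultant_eq0 -leqNgt eq_leq //; apply/eqP/irreducible_coprimep.
Qed.

Lemma poly_length_function (mu : R -> nat) : length_function mu ->
  length_function (fun f : {poly R} => ((size f).-1 + mu (lead_coef f))%N).
Proof.
move=> [muM mu_eq0]; split=> [f g nzf nzg|f nzf].
  rewrite lead_coefM muM ?lead_coef_eq0 // addnACA size_mul //.
  rewrite -!size_poly_gt0 in nzf nzg; congr (_ + _)%N.
  by case: (size f) nzf => // k _; case: (size g) nzg => // l _; rewrite addnS.
move/eqP; rewrite addn_eq0 => /andP[/eqP szf /eqP mu_lead].
have {}szf : size f = 1%N by rewrite -size_poly_gt0 in nzf; rewrite -(prednK nzf) szf.
rewrite poly_unitE szf /=; have := mu_eq0 _ _ mu_lead.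
by rewrite lead_coef_eq0 lead_coefE szf; apply.
Qed.

Lemma poly_ufd : ufd {poly R}.
Proof.
have [mu mu_length] := ufd_length ufdR; split.
  by eexists; apply: poly_length_function mu_length.
move=> f irrf; have [szf|szf] := leqP (size f) 1.
  have def_f := size1_polyC szf; rewrite def_f in irrf *.
  exact/prime_polyC/(ufd_prime ufdR)/irreducible_polyC.
move=> g h div_gh; have prim_f := irreducible_primitive irrf szf.
have [|ndiv] := classic (divides f g); [by left|right].
have [c [u [v [nzc def_c]]]] := irreducible_bezout irrf szf ndiv.
apply: (primitive_divides prim_f nzc); rewrite def_c mulrDl; apply: dividesD.
  by apply: divides_mulr; apply: divides_multiple.
by rewrite -mulrA; apply: divides_mull.
Qed.

End PolyUfd.

(** * Multivariate polynomials *)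

Lemma mpoly_ring_ind (R : nzRingType) (n : nat) (P : {mpoly R[n]} -> Prop) :
  (forall c, P c%:MP) -> (forall i, P 'X_i) ->
  (forall f g, P f -> P g -> P (f + g)) ->
  (forall f g, P f -> P g -> P (f * g)) -> forall f, P f.
Proof.
move=> PC PX PD PM; elim/mpolyind => [|c m f _ _ Pf].
  by rewrite -mpolyC0; apply: PC.
apply: PD => //; rewrite -mul_mpolyC; apply: (PM) => //.
rewrite mpolyXE_id; elim/big_ind: _ => [|g h|i _]; [by rewrite -mpolyC1 | exact: (PM) |].
by elim: (m i) => [|k IH]; rewrite ?expr0 -?mpolyC1 // exprS; apply: PM.
Qed.

Lemma mpoly_rmorph_ext (R S : nzRingType) (n : nat)
    (phi psi : {rmorphism {mpoly R[n]} -> S}) :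
  (forall c, phi c%:MP = psi c%:MP) -> (forall i, phi 'X_i = psi 'X_i) -> phi =1 psi.
Proof.
move=> eqC eqX; elim/mpoly_ring_ind => // f g eqf eqg.
  by rewrite !rmorphD eqf eqg.
by rewrite !rmorphM eqf eqg.
Qed.

Lemma poly_rmorph_ext (R S : nzRingType) (phi psi : {rmorphism {poly R} -> S}) :
  (forall c, phi c%:P = psi c%:P) -> phi 'X = psi 'X -> phi =1 psi.
Proof.
move=> eqC eqX; elim/poly_ind => [|f c eqf]; first by rewrite !rmorph0.
by rewrite !rmorphD !rmorphM eqf eqX eqC.
Qed.

Section Mmap.
Variables (R S : comNzRingType) (n : nat).
Implicit Types (f : {mpoly R[n]}) (phi psi : {rmorphism R -> S}) (h : 'I_n -> S).

Lemma mmapXU phi h i : mmap phi h 'X_i = h i.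
Proof. by rewrite mmapX mmap1U. Qed.

Lemma eq_mmap phi psi h1 h2 f : phi =1 psi -> h1 =1 h2 -> mmap phi h1 f = mmap psi h2 f.
Proof.
move=> eq_phi eq_h.
apply: (@mpoly_rmorph_ext _ _ _ (mmap phi h1) (mmap psi h2)) => [c|j] /=.
  by rewrite !mmapC; apply: eq_phi.
by rewrite !mmapXU.
Qed.

Lemma meval_map_mpoly phi h f : (map_mpoly phi f).@[h] = mmap phi h f.
Proof.
apply: (@mpoly_rmorph_ext _ _ _ (meval h \o map_mpoly phi) (mmap phi h)) => [c|j] /=.
  by rewrite map_mpolyC mevalC mmapC.
by rewrite map_mpolyX mevalXU mmapXU.
Qed.

End Mmap.

Lemma mmap_idX (R : comNzRingType) n (f : {mpoly R[n]}) :
  mmap (@mpolyC n R) (fun j => 'X_j) f = f.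
Proof.
apply: (@mpoly_rmorph_ext _ _ _ (mmap (@mpolyC n R) _) idfun) => [c|j].
  exact: mmapC.
exact: mmapXU.
Qed.

Lemma msize_map_mpoly (R S : nzRingType) n (phi : {rmorphism R -> S}) (f : {mpoly R[n]}) :
  injective phi -> msize (map_mpoly phi f) = msize f.
Proof. by move=> phi_inj; rewrite !mmeasureE; apply/perm_big/msupp_map_mpoly. Qed.

Lemma map_mpoly_eq0 (R S : nzRingType) n (phi : {rmorphism R -> S}) (f : {mpoly R[n]}) :
  injective phi -> (map_mpoly phi f == 0) = (f == 0).
Proof. by move=> phi_inj; rewrite -!msize_poly_eq0 msize_map_mpoly. Qed.

Lemma msize_sum_leq (R : nzRingType) n (I : Type) (r : seq I) (P : pred I)
    (F : I -> {mpoly R[n]}) d :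
  (forall i, P i -> msize (F i) <= d)%N ->
  (msize (\sum_(i <- r | P i) F i)%R <= d)%N.
Proof.
move=> le_d; apply: leq_trans (msize_sum _ _ _) _.
by elim/big_ind: _ => // x y lex ley; rewrite geq_max lex.
Qed.

Section MpolyDomain.
Variables (R : idomainType) (n : nat).
Implicit Types f g h : {mpoly R[n]}.

Lemma msizeM_leq f g d e :
  (msize f <= d.+1 -> msize g <= e.+1 -> msize (f * g)%R <= (d + e).+1)%N.
Proof.
move=> lef leg; have [->|nzf] := eqVneq f 0; first by rewrite mul0r msize0.
have [->|nzg] := eqVneq g 0; first by rewrite mulr0 msize0.
by rewrite msizeM //; lia.
Qed.

Lemma msize_prod_leq (I : Type) (r : seq I) (P : pred I) (F : I -> {mpoly R[n]})
    (d : I -> nat) :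
  (forall i, P i -> msize (F i) <= (d i).+1)%N ->
  (msize (\prod_(i <- r | P i) F i)%R <= (\sum_(i <- r | P i) d i).+1)%N.
Proof.
move=> le_d; elim/big_rec2: _ => [|i e f Pi lef]; first by rewrite msize1.
exact: msizeM_leq (le_d i Pi) lef.
Qed.

Lemma msizeX_leq f d k : (msize f <= d.+1 -> msize (f ^+ k)%R <= (d * k).+1)%N.
Proof.
move=> lef; rewrite mulnC -[k]card_ord -prodr_const -sum_nat_const.
exact: msize_prod_leq.
Qed.

Lemma msize_dvd_leq f g h : f = g * h -> f != 0 -> (msize g <= msize f)%N.
Proof.
move=> -> /[!mulf_eq0] /norP[nzg nzh]; rewrite msizeM // (mpolySpred _ nzh) addnS.
exact: leq_addr.
Qed.

Lemma msize_prod_gt (I : Type) (r : seq I) (F : I -> {mpoly R[n]}) :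
  (forall i, 1 < msize (F i))%N -> (size r < msize (\prod_(i <- r) F i)%R)%N.
Proof.
move=> szF; elim: r => [|i r IH] /=; first by rewrite big_nil msize1.
have nzF : F i != 0 by rewrite -msize_poly_eq0 -lt0n ltnW.
have nzP : \prod_(k <- r) F k != 0.
  by rewrite -msize_poly_eq0 -lt0n (leq_ltn_trans _ IH).
rewrite big_cons msizeM //; move: (szF i) IH.
by move: (msize (F i)) (msize (\prod_(k <- r) F k)) => x y; lia.
Qed.

Lemma msize_exp_gt f k : (1 < msize f)%N -> (k < msize (f ^+ k)%R)%N.
Proof.
move=> szf; have := @msize_prod_gt _ (iota 0 k) (fun=> f) (fun=> szf).
by rewrite big_const_seq count_predT iter_mulr_1 size_iota.
Qed.

Lemma num_factors_ltn (r : nat) (u : R) f (fs : 'I_r -> {mpoly R[n]}) (d : 'I_r -> nat) :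
  f = u%:MP * \prod_k fs k ^+ d k -> f != 0 ->
  (forall k, 1 < msize (fs k))%N -> (forall k, 0 < d k)%N -> (r < msize f)%N.
Proof.
move=> def_f nzf sz_fs d_gt0; have nzu : u != 0.
  by apply: contraNneq nzf => u0; rewrite def_f u0 mpolyC0 mul0r.
rewrite def_f mul_mpolyC msizeZ // -[X in (X < _)%N]card_ord cardE enumT.
by apply: msize_prod_gt => k; apply: leq_ltn_trans (d_gt0 k) (msize_exp_gt _ (sz_fs k)).
Qed.

Lemma msize_subst_affine (k : nat) (h : 'I_k -> {mpoly R[n]}) (f : {mpoly R[k]}) :
  (forall i, msize (h i) <= 2)%N -> (msize (mmap (@mpolyC n R) h f) <= msize f)%N.
Proof.
move=> le_h; rewrite /mmap big_seq; apply: msize_sum_leq => m suppm.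
apply: leq_trans (msize_mdeg_lt suppm); rewrite mul_mpolyC.
apply: leq_trans (msizeZ_le _ _) _; rewrite /mmap1 mdegE.
apply: msize_prod_leq => i _; rewrite -[X in (_ <= X.+1)%N]mul1n.
exact: msizeX_leq.
Qed.

End MpolyDomain.

Lemma mpoly_unitE (F : fieldType) n (f : {mpoly F[n]}) :
  (f \is a GRing.unit) = (msize f == 1%N).
Proof.
apply/andP/msize_poly1P => [[/eqP def_f uf]|[c nzc ->]].
  by exists f@_0%MM; rewrite // -unitfE.
by rewrite mcoeffC eqxx mulr1 unitfE.
Qed.

Lemma irreducible_msize (F : fieldType) n (f : {mpoly F[n]}) :
  irreducible_elt f -> (1 < msize f)%N.
Proof.
by move=> [nzf nuf _]; rewrite ltn_neqAle eq_sym -mpoly_unitE nuf lt0n msize_poly_eq0.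
Qed.

(* If emb f = g * h and rho g is a constant, then g * h has degree at most
   deg f = deg (rho h) <= deg h, so g is a constant. *)
Lemma irreducible_degree_section (F : fieldType) (m n : nat)
    (emb : {rmorphism {mpoly F[m]} -> {mpoly F[n]}})
    (rho : {rmorphism {mpoly F[n]} -> {mpoly F[m]}}) (f : {mpoly F[m]}) :
  cancel emb rho -> (forall g, msize (emb g) <= msize g)%N ->
  (forall g, msize (rho g) <= msize g)%N ->
  irreducible_elt f -> irreducible_elt (emb f).
Proof.
move=> embK le_emb le_rho [nzf nuf irrf].
have nz_emb : emb f != 0 by rewrite -(rmorph0 emb) (inj_eq (can_inj embK)).
have unit_factor g h : emb f = g * h -> rho g \is a GRing.unit -> g \is a GRing.unit.
  move=> def_gh; have [nzg nzh] : g != 0 /\ h != 0.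
    by apply/norP; rewrite -mulf_eq0 -def_gh.
  have def_f : f = rho g * rho h by rewrite -rmorphM -def_gh embK.
  have [nz_rg nz_rh] : rho g != 0 /\ rho h != 0.
    by apply/norP; rewrite -mulf_eq0 -def_f.
  rewrite !mpoly_unitE => /eqP rho_g.
  have : (msize (g * h) <= msize h)%N.
    rewrite -def_gh; apply: leq_trans (le_emb f) _.
    by rewrite def_f msizeM // rho_g add1n; apply: le_rho.
  rewrite msizeM // (mpolySpred _ nzg) (mpolySpred _ nzh) addnS addSn /=.
  by rewrite ltnS -[leqRHS]add0n leq_add2r leqn0 eqSS.
split=> // [|g h def_gh].
  by apply: contra nuf => /(rmorph_unit rho); rewrite embK.
have [|ug|uh] := irrf (rho g) (rho h); first by rewrite -rmorphM -def_gh embK.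
  by left; apply: unit_factor def_gh ug.
by right; apply: unit_factor uh; rewrite mulrC; apply: def_gh.
Qed.

Section LastVariable.
Variables (R : comNzRingType) (n : nat).

Local Notation widen := (widen_ord (leqnSn n)).

Definition muni_inv : {poly {mpoly R[n]}} -> {mpoly R[n.+1]} :=
  horner_eval 'X_ord_max \o map_poly (@mwiden n R).

HB.instance Definition _ := GRing.RMorphism.on muni_inv.

Lemma muni_invC c : muni_inv c%:P = mwiden c.
Proof. by rewrite /muni_inv /= map_polyC /horner_eval hornerC. Qed.

Lemma muni_invX : muni_inv 'X = 'X_ord_max.
Proof. by rewrite /muni_inv /= map_polyX /horner_eval hornerX. Qed.

Lemma muniXE m : muni 'X_[R, m] = 'X_[[multinom m (widen i) | i < n]] *: 'X^(m ord_max).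
Proof. by rewrite muniE msuppX big_seq1 mcoeffX eqxx scale1r. Qed.

Lemma muniX_widen i : muni ('X_(widen i) : {mpoly R[n.+1]}) = ('X_i)%:P.
Proof.
rewrite muniXE mnm1E (_ : widen i == _ = false) ?expr0 ?alg_polyC; last first.
  by rewrite -val_eqE /= ltn_eqF.
by congr ('X_[_]%:P); apply/mnmP => j; rewrite mnmE !mnm1E -!val_eqE.
Qed.

Lemma muniX_max : muni ('X_ord_max : {mpoly R[n.+1]}) = 'X.
Proof.
rewrite muniXE mnm1E eqxx expr1 (_ : [multinom _ | _ < n] = 0%MM) ?mpolyX0 ?scale1r //.
by apply/mnmP => j; rewrite mnmE mnm1E mnm0E -val_eqE /= gtn_eqF.
Qed.

Lemma mwidenXU i : mwiden ('X_i : {mpoly R[n]}) = 'X_(widen i).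
Proof. by rewrite mwidenX mnmwiden1. Qed.

Lemma widen_or_max (P : 'I_n.+1 -> Prop) :
  (forall i, P (widen i)) -> P ord_max -> forall i, P i.
Proof.
move=> Pwiden Pmax i; case: (unliftP ord_max i) => [j ->|-> //].
by rewrite (_ : lift _ _ = widen j) //; apply: val_inj; apply: lift_max.
Qed.

Lemma muniK : cancel (@muni n R) muni_inv.
Proof.
apply: (@mpoly_rmorph_ext _ _ _ (muni_inv \o @muni n R) idfun) => [c|] /=.
  by rewrite muniC muni_invC mwidenC.
apply: widen_or_max => [i|]; last by rewrite muniX_max muni_invX.
by rewrite muniX_widen muni_invC mwidenXU.
Qed.

Lemma muni_invK : cancel muni_inv (@muni n R).
Proof.
apply: (@poly_rmorph_ext _ _ (@muni n R \o muni_inv) idfun) => [c|] /=.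
  rewrite muni_invC.
  apply: (@mpoly_rmorph_ext _ _ _ (@muni n R \o @mwiden n R) polyC) => [d|i] /=.
    by rewrite mwidenC muniC.
  by rewrite mwidenXU muniX_widen.
by rewrite muni_invX muniX_max.
Qed.

End LastVariable.

Lemma mpoly_ufd (R : idomainType) (n : nat) : ufd R -> ufd {mpoly R[n]}.
Proof.
move=> ufdR; elim: n => [|n IH].
  apply: (ufd_iso (phi := @mpolyC 0 R) (psi := mcoeff 0%MM)) ufdR; first exact: mpolyCK.
  exact: mpolyKC.
exact: ufd_iso (@muni_invK R n) (@muniK R n) (poly_ufd IH).
Qed.

(** * Nonvanishing over an algebraically closed field *)

Lemma closed_field_points (K : closedFieldType) (N : nat) :
  exists2 s : seq K, size s = N & uniq s.
Proof.
elim: N => [|N [s szs us]]; first by exists [::].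
have /closed_nonrootP[x] := monic_neq0 (monic_prod_XsubC s xpredT id).
by rewrite root_prod_XsubC => xs; exists (x :: s); rewrite /= ?szs // xs.
Qed.

Lemma mpoly_nonroot (K : closedFieldType) (n : nat) (f : {mpoly K[n]}) :
  f != 0 -> exists v, f.@[v] != 0.
Proof.
elim: n f => [|n IH] f nzf.
  exists (fun=> 0); rewrite (nvar0_mpolyC f) mevalC.
  by rewrite -(mpolyC_eq0 0) -nvar0_mpolyC.
have nz_lead : lead_coef (muni f) != 0.
  by rewrite lead_coef_eq0 -(rmorph0 (@muni n K)) (inj_eq (can_inj (@muniK K n))).
have [v nzv] := IH _ nz_lead.
have /closed_nonrootP[x nzx] : map_poly (meval v) (muni f) != 0.
  apply: contraNneq nzv => f0; rewrite lead_coefE -coef_map.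
  by rewrite [map_poly _ _]f0 coef0.
exists (fun i => oapp v x (unlift ord_max i)); apply: contraNneq nzx => fv.
rewrite rootE; apply/eqP; rewrite -{}fv.
apply: (@mpoly_rmorph_ext _ _ _
  (horner_eval x \o map_poly (meval v) \o @muni n K) (meval _)) => [c|] /=.
  by rewrite muniC map_polyC /= /horner_eval hornerC !mevalC.
apply: widen_or_max => [j|]; last first.
  by rewrite muniX_max map_polyX /horner_eval hornerX mevalXU unlift_none.
rewrite muniX_widen map_polyC /= /horner_eval hornerC !mevalXU.
by rewrite (_ : widen_ord _ j = lift ord_max j) ?liftK //; apply/val_inj/esym/lift_max.
Qed.

Lemma mmap_nonroot (F : fieldType) (K : closedFieldType) (iota : {rmorphism F -> K})
    (n : nat) (f : {mpoly F[n]}) :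
  f != 0 -> exists v, mmap iota v f != 0.
Proof.
rewrite -(map_mpoly_eq0 _ (fmorph_inj iota)) => /mpoly_nonroot[v].
by rewrite meval_map_mpoly; exists v.
Qed.

(** * Restriction to a line *)

Section Line.
Variables (R S : comNzRingType) (n : nat) (phi : {rmorphism R -> S}).
Variables (a b : 'I_n -> S).

Definition line : {mpoly R[n]} -> {poly S} :=
  mmap (polyC \o phi) (fun j => (a j)%:P + (b j)%:P * 'X).

HB.instance Definition _ := GRing.RMorphism.on line.

Lemma lineC c : line c%:MP = (phi c)%:P.
Proof. by rewrite /line mmapC. Qed.

Lemma lineX j : line 'X_j = (a j)%:P + (b j)%:P * 'X.
Proof. by rewrite /line mmapXU. Qed.

Lemma size_line f : (size (line f) <= msize f)%N.
Proof.
rewrite /line /mmap big_seq; elim/big_ind: _ => [|P Q szP szQ|m suppm].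
- by rewrite size_poly0.
- by rewrite (leq_trans (size_polyD _ _)) // geq_max szP.
apply: leq_trans (msize_mdeg_lt suppm); rewrite /= mul_polyC.
apply: leq_trans (size_scale_leq _ _) _; apply: leq_trans (size_poly_prod_leq _ _) _.
have size_linear j : (size ((a j)%:P + (b j)%:P * 'X)%R <= 2)%N.
  by rewrite addrC size_MXaddC; case: ifP => //; rewrite ltnS size_polyC_leq1.
have size_power j : (size (((a j)%:P + (b j)%:P * 'X) ^+ m j)%R <= (m j).+1)%N.
  apply: leq_trans (size_poly_exp_leq _ _) _; rewrite ltnS -[leqRHS]mul1n leq_mul2r.
  by rewrite -[_.-1]subn1 leq_subLR (size_linear j) orbT.
rewrite leq_subLR addnS ltnS mdegE -sum1_card -big_split /=.
exact: leq_sum.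
Qed.

Lemma size_line_eq f : (line f)`_(msize f).-1 != 0 -> size (line f) = msize f.
Proof.
move=> nz_lead; apply/eqP; rewrite eqn_leq size_line leqNgt.
apply: contraNN nz_lead => lt_size.
by rewrite nth_default // -ltnS (ltn_predK lt_size).
Qed.

Lemma horner_line f t : (line f).[t] = mmap phi (fun j => a j + b j * t) f.
Proof.
apply: (@mpoly_rmorph_ext _ _ _ (horner_eval t \o line)
          (mmap phi (fun j => a j + b j * t))) => [c|j] /=.
  by rewrite lineC /horner_eval hornerC mmapC.
by rewrite lineX /horner_eval !hornerE mmapXU.
Qed.

Lemma horner0_line f : (line f).[0] = mmap phi a f.
Proof. by rewrite horner_line; apply: eq_mmap => // j; rewrite mulr0 addr0. Qed.

End Line.

Lemma map_line (R S T : comNzRingType) n (phi : {rmorphism R -> S})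
    (psi : {rmorphism S -> T}) (chi : {rmorphism R -> T})
    (a b : 'I_n -> S) (a' b' : 'I_n -> T) f :
  (forall c, psi (phi c) = chi c) ->
  (forall j, psi (a j) = a' j) -> (forall j, psi (b j) = b' j) ->
  map_poly psi (line phi a b f) = line chi a' b' f.
Proof.
move=> eqC eqa eqb.
apply: (@mpoly_rmorph_ext _ _ _ (map_poly psi \o line phi a b)
          (line chi a' b')) => [c|j] /=.
  by rewrite !lineC map_polyC /= eqC.
by rewrite !lineX rmorphD rmorphM /= !map_polyC map_polyX /= eqa eqb.
Qed.

Lemma line_map_mpoly (R S T : comNzRingType) n (phi : {rmorphism R -> S})
    (psi : {rmorphism S -> T}) (a b : 'I_n -> T) (f : {mpoly R[n]}) :
  line psi a b (map_mpoly phi f) = line (psi \o phi) a b f.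
Proof.
apply: (@mpoly_rmorph_ext _ _ _ (line psi a b \o map_mpoly phi)
          (line (psi \o phi) a b)) => [c|j] /=.
  by rewrite map_mpolyC !lineC.
by rewrite map_mpolyX !lineX.
Qed.

(* f(T x) as a polynomial in T *)
Definition dilate (R : comNzRingType) n : {mpoly R[n]} -> {poly {mpoly R[n]}} :=
  line (@mpolyC n R) (fun=> 0) (fun j => 'X_j).

HB.instance Definition _ (R : comNzRingType) n := GRing.RMorphism.on (@dilate R n).

(* f(x + y b) as a polynomial in y *)
Definition translate (R : comNzRingType) n (b : 'I_n -> {mpoly R[n]}) :
    {mpoly R[n]} -> {poly {mpoly R[n]}} :=
  line (@mpolyC n R) (fun j => 'X_j) b.

HB.instance Definition _ (R : comNzRingType) n b := GRing.RMorphism.on (@translate R n b).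

(* f(y b) as a polynomial in y *)
Definition central_line (R : comNzRingType) n (b : 'I_n -> R) : {mpoly R[n]} -> {poly R} :=
  line idfun (fun=> 0) b.

HB.instance Definition _ (R : comNzRingType) n b := GRing.RMorphism.on (@central_line R n b).

Section Dilate.
Variables (R : comNzRingType) (n : nat).
Implicit Types f : {mpoly R[n]}.

Lemma coef_dilate f k : (dilate f)`_k = pihomog mdeg k f.
Proof.
have dilateX m : dilate 'X_[m] = 'X_[R, m]%:P * 'X^(mdeg m).
  rewrite /dilate /line mmapX /mmap1 mdegE -prodrXr mpolyXE_id rmorph_prod /=.
  rewrite -big_split /=; apply: eq_bigr => j _.
  by rewrite add0r exprMn rmorphXn.
rewrite pihomogE [in RHS]big_mkcond {1}(mpolyE f) rmorph_sum coef_sum /=.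
apply: eq_bigr => m _; rewrite -mul_mpolyC rmorphM /= dilateX {1}/dilate lineC.
rewrite mulrA -rmorphM /= mul_mpolyC coefCM coefXn eq_sym.
by case: eqP; rewrite ?mulr1 ?mulr0.
Qed.

Lemma coef0_dilate f : (dilate f)`_0 = (f@_0%MM)%:MP.
Proof.
rewrite -horner_coef0 horner0_line.
apply: (@mpoly_rmorph_ext _ _ _ (mmap (@mpolyC n R) (fun=> 0)) (@mpolyC n R \o mcoeff 0%MM))
  => [c|j] /=.
  by rewrite mmapC mcoeffC eqxx mulr1.
by rewrite mmapXU mcoeffX mnm1_eq0 mpolyC0.
Qed.

Lemma dilate_horner1 f : (dilate f).[1] = f.
Proof.
by rewrite horner_line -[RHS]mmap_idX; apply: eq_mmap => // j; rewrite add0r mulr1.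
Qed.

Lemma size_dilate f : size (dilate f) = msize f.
Proof.
apply/eqP; rewrite eqn_leq size_line /= -{1}(dilate_horner1 f) horner_coef.
apply: msize_sum_leq => i _; rewrite expr1n mulr1 coef_dilate msizeE.
apply/bigmax_leqP_seq => m suppm _.
by rewrite [mdeg m](dhomog_mf (pihomogP _ _ _) suppm).
Qed.

End Dilate.

Section Translate.
Variables (R : comNzRingType) (n : nat) (b : 'I_n -> {mpoly R[n]}).
Implicit Types f g : {mpoly R[n]}.

Lemma translate_coef0 f : (translate b f)`_0 = f.
Proof. by rewrite -horner_coef0 horner0_line mmap_idX. Qed.

Lemma translate_coef1 f : (translate b f)`_1 = \sum_j f^`M(j) * b j.
Proof.
elim/mpoly_ring_ind: f => [c|i|f g eqf eqg|f g eqf eqg].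
- by rewrite /translate lineC coefC big1 // => j _; rewrite mderivC mul0r.
- rewrite /translate lineX coefD coefC coefMX coefC add0r (bigD1 i) //=.
  rewrite mderivX mnm1E eqxx big1 => [|j neq_ji]; last first.
    by rewrite mderivX mnm1E eq_sym (negPf neq_ji) scale0r mul0r.
  suff -> : (U_(i) - U_(i) = 0)%MM by rewrite mpolyX0 scale1r mul1r addr0.
  by apply/mnmP => k; rewrite mnmBE subnn mnm0E.
- rewrite rmorphD coefD; apply: etrans (congr2 +%R eqf eqg) _.
  by rewrite -big_split /=; apply: eq_bigr => j _; rewrite mderivD mulrDl.
rewrite rmorphM coefM !big_ord_recl big_ord0 addr0 /=.
apply: etrans (congr2 +%R (congr2 *%R (translate_coef0 f) eqg)
                          (congr2 *%R eqf (translate_coef0 g))) _.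
rewrite big_distrr big_distrl -big_split; apply: eq_bigr => j _ /=.
by rewrite mderivM; ring.
Qed.

End Translate.

(** * A generic line *)

Lemma irreducible_divides_associated (R : idomainType) (x y : R) :
  irreducible_elt x -> irreducible_elt y -> divides x y -> associated x y.
Proof.
move=> [_ nux _] [_ _ irry] [c def_y].
have [uc|] := irry _ _ def_y; last by rewrite (negPf nux).
by exists c^-1; rewrite ?unitrV // def_y mulKr.
Qed.

Lemma not_divides_deriv (R : idomainType) (P : {poly R}) : P^`() != 0 -> ~ divides P P^`().
Proof.
move=> nzP' [Q def_P']; have /norP[nzQ nzP] : ~~ ((Q == 0) || (P == 0)).
  by rewrite -mulf_eq0 -def_P'.
have := lt_size_deriv nzP; rewrite def_P' size_mul //.
by rewrite -[size Q]prednK ?size_poly_gt0 // addSn ltnNge leq_addl.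
Qed.

Section GenericLine.
Variables (F : fieldType) (n : nat).
Implicit Types f g : {mpoly F[n]}.

Local Notation R := {mpoly F[n + n]}.

Definition gen_pt (j : 'I_n) : R := 'X_(lshift n j).
Definition gen_dir (j : 'I_n) : R := 'X_(rshift n j).

Definition gen_line : {mpoly F[n]} -> {poly R} := line (@mpolyC (n + n) F) gen_pt gen_dir.

HB.instance Definition _ := GRing.RMorphism.on gen_line.

Lemma gen_rmorph_ext (S : nzRingType) (phi psi : {rmorphism R -> S}) :
  (forall c, phi c%:MP = psi c%:MP) -> (forall j, phi (gen_pt j) = psi (gen_pt j)) ->
  (forall j, phi (gen_dir j) = psi (gen_dir j)) -> phi =1 psi.
Proof.
move=> eqC eqx eqb; apply: mpoly_rmorph_ext => // i.
by rewrite -(splitK i); case: (split i) => j; [apply: eqx | apply: eqb].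
Qed.

Section Specialize.
Variables (S : comNzRingType) (phi : {rmorphism F -> S}) (a b : 'I_n -> S).

Definition specialize : R -> S :=
  mmap phi (fun i => match split i with inl j => a j | inr j => b j end).

HB.instance Definition _ := GRing.RMorphism.on specialize.

Lemma specializeC c : specialize c%:MP = phi c.
Proof. exact: mmapC. Qed.

Lemma specialize_pt j : specialize (gen_pt j) = a j.
Proof. by rewrite /specialize mmapXU (unsplitK (inl j)). Qed.

Lemma specialize_dir j : specialize (gen_dir j) = b j.
Proof. by rewrite /specialize mmapXU (unsplitK (inr j)). Qed.

Lemma specialize_gen_line f : map_poly specialize (gen_line f) = line phi a b f.
Proof.
by apply: map_line => [c|j|j];
  [apply: specializeC | apply: specialize_pt | apply: specialize_dir].
Qed.

End Specialize.

Lemma specialize_nonzero (K : closedFieldType) (iota : {rmorphism F -> K}) (W : R) :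
  W != 0 -> exists a b, specialize iota a b W != 0.
Proof.
move/(mmap_nonroot iota) => [v nzv].
exists (v \o @lshift n n), (v \o @rshift n n); rewrite /specialize.
rewrite (@eq_mmap _ _ _ _ iota _ v) // => i /=.
by rewrite -{2}(splitK i); case: (split i).
Qed.

(* The automorphism x -> x + s y b of F[x, b][y] *)
Definition shear (s : R) : {poly R} -> {poly R} :=
  horner_eval 'X \o
  map_poly (specialize (polyC \o @mpolyC (n + n) F)
    (fun j => (gen_pt j)%:P + (s * gen_dir j)%:P * 'X) (fun j => (gen_dir j)%:P)).

HB.instance Definition _ s := GRing.RMorphism.on (shear s).

Lemma shearC s c : shear s c%:MP%:P = c%:MP%:P.
Proof. by rewrite /shear /= map_polyC /horner_eval hornerC /= specializeC. Qed.

Lemma shear_pt s j :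
  shear s (gen_pt j)%:P = (gen_pt j)%:P + (s * gen_dir j)%:P * 'X.
Proof. by rewrite /shear /= map_polyC /horner_eval hornerC /= specialize_pt. Qed.

Lemma shear_dir s j : shear s (gen_dir j)%:P = (gen_dir j)%:P.
Proof. by rewrite /shear /= map_polyC /horner_eval hornerC /= specialize_dir. Qed.

Lemma shearX s : shear s 'X = 'X.
Proof. by rewrite /shear /= map_polyX /horner_eval hornerX. Qed.

Lemma shearNK (c : F) : cancel (shear (- c)%:MP) (shear c%:MP).
Proof.
apply: (@poly_rmorph_ext _ _ (shear c%:MP \o shear (- c)%:MP) idfun) => [d|] /=; last first.
  by rewrite !shearX.
apply: (@gen_rmorph_ext _ (shear c%:MP \o shear (- c)%:MP \o polyC) polyC) => [e|j|j] /=.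
- by rewrite !shearC.
- rewrite shear_pt rmorphD rmorphM /= polyCM rmorphM /= shear_pt shearC shear_dir shearX.
  by rewrite -!polyCM mpolyCN mulNr polyCN mulNr addrK.
- by rewrite !shear_dir.
Qed.

Definition gen_emb : {mpoly F[n]} -> R := mmap (@mpolyC (n + n) F) gen_pt.

HB.instance Definition _ := GRing.RMorphism.on gen_emb.

Lemma irreducible_gen_emb f : irreducible_elt f -> irreducible_elt (gen_emb f).
Proof.
apply: (irreducible_degree_section (emb := gen_emb)
  (rho := specialize (@mpolyC n F) (fun j => 'X_j) (fun=> 0))) => g.
- apply: (@mpoly_rmorph_ext _ _ _
    (specialize (@mpolyC n F) (fun j => 'X_j) (fun=> 0) \o gen_emb) idfun) => [c|j] /=.
    by rewrite /gen_emb mmapC specializeC.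
  by rewrite /gen_emb mmapXU specialize_pt.
- by apply: msize_subst_affine => i; rewrite msizeX mdeg1.
- apply: msize_subst_affine => i; case: (split i) => j; last by rewrite msize0.
  by rewrite msizeX mdeg1.
Qed.

Lemma shear_gen_emb f : shear 1%:MP (gen_emb f)%:P = gen_line f.
Proof.
apply: (@mpoly_rmorph_ext _ _ _ (shear 1%:MP \o polyC \o gen_emb) gen_line) => [c|j] /=.
  by rewrite /gen_line lineC /gen_emb mmapC shearC.
by rewrite /gen_line lineX /gen_emb mmapXU shear_pt mpolyC1 mul1r.
Qed.

Lemma irreducible_gen_line f : irreducible_elt f -> irreducible_elt (gen_line f).
Proof.
have shearK : cancel (shear 1%:MP) (shear (- 1)%:MP).
  by rewrite -{1}[1]opprK; apply: shearNK.
move=> /irreducible_gen_emb/irreducible_polyC/(irreducible_iso shearK (shearNK 1)).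
by rewrite /= shear_gen_emb.
Qed.

Lemma divides_gen_line f g : divides (gen_line f) (gen_line g) -> divides f g.
Proof.
pose restrict := horner_eval 0 \o
  map_poly (specialize (@mpolyC n F) (fun j => 'X_j) (fun=> 0)).
have gen_lineK h : restrict (gen_line h) = h.
  by rewrite /restrict /= specialize_gen_line /horner_eval horner0_line mmap_idX.
by move=> div_fg; rewrite -(gen_lineK f) -(gen_lineK g); apply: (divides_rmorph restrict).
Qed.

Lemma gen_line_coef0_neq0 f : f != 0 -> (gen_line f)`_0 != 0.
Proof.
apply: contraNneq => line0; rewrite -[f](translate_coef0 (fun=> 0)) /translate.
by rewrite -(specialize_gen_line (@mpolyC n F)) coef_map /= line0 rmorph0.
Qed.

Lemma gen_line_lead_neq0 f : f != 0 -> (gen_line f)`_(msize f).-1 != 0.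
Proof.
rewrite -msize_poly_eq0 -{1}size_dilate size_poly_eq0 -lead_coef_eq0 lead_coefE size_dilate.
apply: contraNneq => lead0; rewrite /dilate -(specialize_gen_line (@mpolyC n F)).
by rewrite coef_map /= lead0 rmorph0.
Qed.

Lemma size_gen_line f : size (gen_line f) = msize f.
Proof.
have [->|nzf] := eqVneq f 0; first by rewrite rmorph0 size_poly0 msize0.
exact/size_line_eq/gen_line_lead_neq0.
Qed.

Lemma gen_line_deriv_neq0 f j : f^`M(j) != 0 -> (gen_line f)^`() != 0.
Proof.
have -> : f^`M(j) = (translate (fun i => (i == j)%:R) f)`_1.
  rewrite translate_coef1 (bigD1 j) //= eqxx mulr1 big1 ?addr0 // => i /negPf->.
  by rewrite mulr0.
apply: contraNneq => deriv0.
rewrite /translate -(specialize_gen_line (@mpolyC n F)) coef_map /=.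
by rewrite -[X in specialize _ _ _ X](coef_deriv (gen_line f) 0) deriv0 coef0 rmorph0.
Qed.

End GenericLine.

(* The zeros of the fs k on the line t |-> a + t b have multiplicity one, are
   pairwise disjoint, and none is at t = 0 or at infinity. *)
Record separating_line (F K : fieldType) (iota : {rmorphism F -> K}) (n r : nat)
    (a b : 'I_n -> K) (fs : 'I_r -> {mpoly F[n]}) : Prop := SeparatingLine {
  separating_size : forall k, size (line iota a b (fs k)) = msize (fs k);
  separating_root0 : forall k, ~~ root (line iota a b (fs k)) 0;
  separating_deriv : forall k z,
    root (line iota a b (fs k)) z -> ~~ root (line iota a b (fs k))^`() z;
  separating_disjoint : forall i k z, k != i ->
    root (line iota a b (fs i)) z -> ~~ root (line iota a b (fs k)) z
}.

Lemma bezout_no_common_root (S : comNzRingType) (K : idomainType) (rho : {rmorphism S -> K})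
    (P Q u v : {poly S}) (c : S) (z : K) :
  c%:P = u * P + v * Q -> rho c != 0 ->
  root (map_poly rho P) z -> ~~ root (map_poly rho Q) z.
Proof.
move=> def_c nzc /rootP Pz; apply: contraNN nzc => /rootP Qz.
have := congr1 (horner_eval z \o map_poly rho) def_c.
by rewrite rmorphD !rmorphM /= map_polyC /= /horner_eval hornerC Pz Qz !mulr0 addr0 => ->.
Qed.

Section SeparatingLine.
Variables (F : fieldType) (n r : nat) (fs : 'I_r -> {mpoly F[n]}).
Hypothesis irr_fs : forall i, irreducible_elt (fs i).
Hypothesis fs_inj : forall i k, associated (fs i) (fs k) -> i = k.
Hypothesis separable_fs : forall i, exists j, (fs i)^`M(j) != 0.

Let competitor i k :=
  if i == k then (gen_line (fs i))^`() else gen_line (fs k).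

Let competitor_bezout i k :
  exists c u v, c != 0 /\ c%:P = u * gen_line (fs i) + v * competitor i k.
Proof.
apply: irreducible_bezout; first exact/mpoly_ufd/field_ufd.
- exact: irreducible_gen_line.
- by rewrite size_gen_line irreducible_msize.
rewrite /competitor; case: eqVneq => [_|/eqP neq_ik].
  by apply: not_divides_deriv; have [j] := separable_fs i; apply: gen_line_deriv_neq0.
by move/divides_gen_line/irreducible_divides_associated => /(_ (irr_fs i) (irr_fs k))/fs_inj.
Qed.

Lemma separating_line_exists (K : closedFieldType) (iota : {rmorphism F -> K}) :
  exists a b, separating_line iota a b fs.
Proof.
have /fin_all_exists[c bezout_c] (ik : 'I_r * 'I_r) := competitor_bezout ik.1 ik.2.
pose W := (\prod_ik c ik) *
  \prod_i ((gen_line (fs i))`_(msize (fs i)).-1 * (gen_line (fs i))`_0).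
have [|a [b]] := @specialize_nonzero _ _ _ iota W.
  rewrite mulf_neq0 //; apply/prodf_neq0 => i _; first by have [u [v []]] := bezout_c i.
  have [nzf _ _] := irr_fs i.
  by rewrite mulf_neq0 ?gen_line_lead_neq0 ?gen_line_coef0_neq0.
rewrite rmorphM !rmorph_prod /= mulf_eq0 => /norP[/prodf_neq0 nzc /prodf_neq0 nz_coef].
have {nz_coef} nz_coef i : (line iota a b (fs i))`_(msize (fs i)).-1 != 0 /\
    (line iota a b (fs i))`_0 != 0.
  apply/norP; rewrite -mulf_eq0 -specialize_gen_line !coef_map -rmorphM.
  exact: nz_coef.
have no_common_root i k z : root (line iota a b (fs i)) z ->
    ~~ root (map_poly (specialize iota a b) (competitor i k)) z.
  have [u [v [_ def_c]]] := bezout_c (i, k).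
  rewrite -specialize_gen_line; apply: bezout_no_common_root def_c _.
  exact: (nzc (i, k)).
exists a, b; split=> [k|k|k z|i k z neq_ki].
- by have [nz_lead _] := nz_coef k; apply: size_line_eq.
- by have [_] := nz_coef k; rewrite rootE horner_coef0.
- by move/(no_common_root k k); rewrite /competitor eqxx -deriv_map specialize_gen_line.
- move/(no_common_root i k); rewrite /competitor eq_sym (negPf neq_ki).
  by rewrite specialize_gen_line.
Qed.

End SeparatingLine.

(** * The Frobenius and perfect fields *)

Definition frobenius_iter (R : comNzRingType) p of p \in [pchar R] :=
  fun (k : nat) (x : R) => x ^+ (p ^ k).

Section IteratedFrobenius.
Variables (R : comNzRingType) (p : nat) (charR : p \in [pchar R]) (k : nat).

Lemma frobenius_iter_is_nmod_morphism : nmod_morphism (frobenius_iter charR k).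
Proof.
have p_pr := pcharf_prime charR; rewrite /frobenius_iter; split=> [|x y].
  by rewrite expr0n expn_eq0 eqn0Ngt prime_gt0.
by rewrite exprDn_pchar // pnatX pnatE // charR.
Qed.

Lemma frobenius_iter_is_monoid_morphism : monoid_morphism (frobenius_iter charR k).
Proof. by rewrite /frobenius_iter; split=> [|x y]; rewrite ?expr1n ?exprMn. Qed.

HB.instance Definition _ := GRing.isNmodMorphism.Build R R (frobenius_iter charR k)
  frobenius_iter_is_nmod_morphism.
HB.instance Definition _ := GRing.isMonoidMorphism.Build R R (frobenius_iter charR k)
  frobenius_iter_is_monoid_morphism.

End IteratedFrobenius.

Lemma Fp_frobenius_iter (p k : nat) (x : 'F_p) : prime p -> x ^+ (p ^ k) = x.
Proof.
move=> p_pr; elim: k => [|k IH]; first by rewrite expr1.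
by rewrite expnSr exprM IH -[X in _ ^+ X](card_Fp p_pr) expf_card.
Qed.

Lemma root_Fp_frobenius_iter (p k : nat) (K : fieldType) (phi : {rmorphism 'F_p -> K})
    (q : {poly 'F_p}) (z : K) :
  prime p -> root (map_poly phi q) z -> root (map_poly phi q) (z ^+ (p ^ k)).
Proof.
move=> p_pr; have charK := rmorph_pchar phi (pchar_Fp p_pr).
have frob_q : map_poly (frobenius_iter charK k) (map_poly phi q) = map_poly phi q.
  apply/polyP => i; rewrite !coef_map /= /frobenius_iter -rmorphXn /=.
  by rewrite Fp_frobenius_iter.
by rewrite -{2}frob_q -[z ^+ _]/(frobenius_iter charK k z) fmorph_root.
Qed.

(* The conjugates x ^+ (p ^ k) are roots of one polynomial, so two of them agree. *)
Lemma algebraic_pth_power (p : nat) (F : fieldType) (K : closedFieldType)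
    (phi : {rmorphism 'F_p -> K}) (iota : {rmorphism F -> K}) (x : F) :
  p \in [pchar F] -> prime_field_closure phi -> exists y, x = y ^+ p.
Proof.
move=> charF closureK; have p_pr := pcharf_prime charF.
have [q nzq qz] := closureK (iota x).
pose s := mkseq (fun k => iota x ^+ (p ^ k)) (size q).
have /(uniqPn 0) [i [j [lt_ij]]] : ~~ uniq s.
  apply/negP => us; have nzq' : map_poly phi q != 0 by rewrite map_poly_eq0.
  have all_roots : all (root (map_poly phi q)) s.
    by apply/allP => z /mapP[k _ ->]; apply: root_Fp_frobenius_iter.
  have := max_poly_roots nzq' all_roots us.
  by rewrite size_mkseq size_map_poly ltnn.
rewrite size_mkseq => lt_j; rewrite !nth_mkseq ?(ltn_trans lt_ij) //.
rewrite -!rmorphXn => /fmorph_inj; rewrite -{1}(subnK lt_ij) addnS -addSn expnD exprM.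
move/(fmorph_inj (frobenius_iter charF i)) => ->.
by exists (x ^+ (p ^ (j - i.+1))); rewrite expnSr exprM.
Qed.

Lemma mpoly_pchar (R : nzRingType) (n p : nat) :
  p \in [pchar R] -> p \in [pchar {mpoly R[n]}].
Proof. exact: (rmorph_pchar (@mpolyC n R)). Qed.

Lemma irreducible_mderiv (p n : nat) (F : fieldType) (f : {mpoly F[n]}) :
  p \in [pchar F] -> (forall x : F, exists y, x = y ^+ p) ->
  irreducible_elt f -> exists j, f^`M(j) != 0.
Proof.
move=> charF perfect [nzf nuf irrf]; apply: NNPP => no_deriv.
have deriv0 j : f^`M(j) = 0 by apply/eqP/negPn/negP => nz; apply: no_deriv; exists j.
have charM := mpoly_pchar n charF.
have p_pr := pcharf_prime charF.
suff [g def_f] : exists g, f = g ^+ p.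
  have nug : g \isn't a GRing.unit by apply: contra nuf; rewrite def_f; apply: unitrX.
  have [||ug] := irrf g (g ^+ p.-1).
  - by rewrite -exprS prednK ?prime_gt0.
  - exact/negP.
  - by move: ug; rewrite unitrX_pos ?(negPf nug) // -ltnS prednK ?prime_gt0 ?prime_gt1.
rewrite (mpolyE f) big_seq; elim/big_ind: _ => [|_ _ [g ->] [h ->]|m suppm].
- by exists 0; rewrite expr0n eqn0Ngt prime_gt0.
- by exists (g + h); rewrite exprDn_pchar // pnatE.
have [c ->] := perfect f@_m; exists (c *: 'X_[[multinom (m j %/ p)%N | j < n]]).
rewrite exprZn mpolyXn; congr (_ *: 'X_[_]); apply/mnmP => j.
rewrite mulmnE mnmE divnK // (dvdn_pcharf charF).
have [->|nzm] := eqVneq (m j) 0%N; first by [].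
have def_m : m = (m - U_(j) + U_(j))%MM by rewrite submK // lep1mP.
have := mcoeff_mderiv j f (m - U_(j))%MM; rewrite deriv0 mcoeff0 -def_m.
rewrite mnmBE mnm1E eqxx subn1 prednK ?lt0n // -[f@_m *+ _]mulr_natr => /esym/eqP.
by rewrite mulf_eq0 mcoeff_eq0 suppm.
Qed.

(** * Taylor expansion of univariate polynomials *)

Section Taylor.
Variable R : comNzRingType.
Implicit Types (P Q : {poly R}) (x y h : R).

Lemma taylor_remainder P k y h :
  exists c, P.[y + h] = \sum_(i < k) P^`N(i).[y] * h ^+ i + c * h ^+ k.
Proof.
exists (\sum_(i < size P) P^`N(k + i).[y] * h ^+ i).
rewrite (@nderiv_taylor_wide _ (k + size P)) ?leq_addl //; last exact: mulrC.
rewrite big_split_ord mulr_suml; congr (_ + _); apply: eq_bigr => i _.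
by rewrite exprD mulrCA mulrC.
Qed.

Lemma divides_horner_sub P x y : divides (x - y) (P.[x] - P.[y]).
Proof.
have [c] := taylor_remainder P 1 y (x - y).
rewrite addrC subrK big_ord1 nderivn0 expr0 mulr1 => ->.
by rewrite addrAC subrr add0r; apply: divides_multiple.
Qed.

Lemma horner_taylor2 P y h :
  exists c, P.[y + h] = P.[y] + P^`().[y] * h + c * h ^+ 2.
Proof.
have [c ->] := taylor_remainder P 2 y h; exists c.
by rewrite big_ord_recr big_ord1 /= nderivn0 poly.nderivn1 expr0 mulr1.
Qed.

Lemma horner_nderivn P k x : P^`N(k).[x] = (P \Po ('X + x%:P))`_k.
Proof.
elim/poly_ind: P k => [|P c IH] k.
  by rewrite comp_poly0 coef0 nderivn_poly0 ?size_poly0 // horner0.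
rewrite comp_polyD comp_polyM comp_polyX comp_polyC coefD coefC mulrDr coefD.
rewrite coefMX coefMC; case: k => [|k] /=.
  by rewrite nderivn0 hornerMXaddC add0r -IH nderivn0.
by rewrite nderivnMXaddC hornerD hornerMX !IH addr0.
Qed.

Lemma deriv_nderivn P k : P^`N(k)^`() = P^`N(k.+1) *+ k.+1.
Proof.
apply/polyP => i; rewrite coef_deriv coefMn !coef_nderivn addSn addnS -!mulrnA.
congr (_ *+ _); rewrite mulnC [RHS]mulnC mul_bin_left; congr (_ * _)%N.
by rewrite subSn ?leq_addr // addKn.
Qed.

Lemma nderivn_XsubC_expM Q x m : (('X - x%:P) ^+ m * Q)^`N(m).[x] = Q.[x].
Proof.
rewrite horner_nderivn rmorphM rmorphXn /= comp_polyB comp_polyX comp_polyC addrK.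
by rewrite coefXnM ltnn subnn -horner_coef0 horner_comp !hornerE.
Qed.

Lemma divides_nderivn_expM P Q x m k : (k < m)%N ->
  divides P.[x] (P ^+ m * Q)^`N(k).[x].
Proof.
move=> lt_km; rewrite horner_nderivn rmorphM rmorphXn /=.
set P' := P \Po _; have P'0 : P'`_0 = P.[x].
  by rewrite -horner_coef0 horner_comp !hornerE.
have def_P' : P' - drop_poly 1 P' * 'X = P.[x]%:P.
  rewrite -{1}(poly_take_drop 1 P') /take_poly poly_def big_ord1 alg_polyC P'0.
  by rewrite addrK.
rewrite -[P' ^+ m](subrK ((drop_poly 1 P' * 'X) ^+ m)) subrXX def_P'.
set geometric_sum := \sum_(i < m) _; rewrite mulrDl coefD.
rewrite exprMn (mulrAC (_ ^+ m)) coefMXn lt_km addr0 -mulrA coefCM.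
exact: divides_mulr (ex_intro _ 1 (esym (mul1r _))).
Qed.

End Taylor.

Lemma simple_root_nderivn_expM (K : idomainType) (g R : {poly K}) (m : nat) (a : K) :
  m%:R != 0 :> K -> root g a -> ~~ root g^`() a -> ~~ root R a ->
  ~~ root (g ^+ m * R)^`N(m.-1)^`() a.
Proof.
move=> nzm ga g'a Ra; have m_gt0 : (0 < m)%N by case: m nzm; rewrite ?eqxx.
have /factor_theorem[q def_g] := ga.
rewrite deriv_nderivn prednK // rootE hornerMn -mulr_natr mulf_neq0 //.
rewrite def_g exprMn -(mulrA (q ^+ m)) mulrCA nderivn_XsubC_expM.
rewrite hornerM mulf_neq0 // horner_exp expf_neq0 //.
by move: g'a; rewrite def_g derivM derivXsubC rootE !hornerE subrr mulr0 add0r.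
Qed.

(** * Order of vanishing at the origin *)

Definition vanishes (R : comNzRingType) (n N : nat) (f : {mpoly R[n]}) : Prop :=
  divides 'X^N (dilate f).

Definition truncate (R : nzRingType) (n N : nat) (f : {mpoly R[n]}) : {mpoly R[n]} :=
  \sum_(k < N) pihomog mdeg k f.

Section Vanishes.
Variables (R : idomainType) (n : nat).
Implicit Types f g u w : {mpoly R[n]}.

Lemma vanishes_leq N M f : (N <= M)%N -> vanishes M f -> vanishes N f.
Proof.
move=> leNM; apply: divides_trans; exists ('X^(M - N)).
by rewrite -exprD subnK.
Qed.

Lemma vanishes0r N : vanishes N (0 : {mpoly R[n]}).
Proof. by rewrite /vanishes rmorph0; apply: divides0. Qed.

Lemma vanishesD N f g : vanishes N f -> vanishes N g -> vanishes N (f + g).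
Proof. by rewrite /vanishes rmorphD; apply: dividesD. Qed.

Lemma vanishesM N M f g : vanishes N f -> vanishes M g -> vanishes (N + M) (f * g).
Proof.
move=> [u def_f] [v def_g]; exists (u * v).
by rewrite rmorphM /= def_f def_g exprD mulrACA.
Qed.

Lemma vanishes_mulr N f g : vanishes N f -> vanishes N (f * g).
Proof. by rewrite /vanishes rmorphM; apply: divides_mulr. Qed.

Lemma vanishes_mull N f g : vanishes N g -> vanishes N (f * g).
Proof. by rewrite mulrC; apply: vanishes_mulr. Qed.

Lemma vanishesN N f : vanishes N f -> vanishes N (- f).
Proof. by rewrite -mulN1r; apply: vanishes_mull. Qed.

Lemma vanishesB N f g : vanishes N f -> vanishes N g -> vanishes N (f - g).
Proof. by move=> van_f van_g; apply/vanishesD/vanishesN. Qed.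

Lemma vanishes_divides N f g : divides f g -> vanishes N f -> vanishes N g.
Proof. by move=> [c ->]; apply: vanishes_mull. Qed.

Lemma vanishesX k f : vanishes 1 f -> vanishes k (f ^+ k).
Proof.
move=> f0; elim: k => [|k IH]; last by rewrite exprS -add1n; apply: vanishesM.
by exists (dilate 1); rewrite mulr1.
Qed.

Lemma vanishes1P f : vanishes 1 f <-> f@_0%MM = 0.
Proof.
split=> [[g def_f]|f0].
  apply: (can_inj (@mpolyCK n R)).
  by rewrite -coef0_dilate def_f expr1 coefMX eqxx mpolyC0.
exists (drop_poly 1 (dilate f)); rewrite -{1}(poly_take_drop 1 (dilate f)).
by rewrite /take_poly poly_def big_ord1 coef0_dilate f0 mpolyC0 scale0r add0r.
Qed.

Lemma vanishes_mul_unit N u w : u@_0%MM != 0 -> vanishes N (u * w) -> vanishes N w.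
Proof.
move=> nzu; elim: N => [|N IH] van_uw; first by exists (dilate w); rewrite mulr1.
have [g def_w] := IH (vanishes_leq (leqnSn N) van_uw).
have [h] := van_uw; rewrite rmorphM /= def_w exprS !mulrA.
move/(mulIf (monic_neq0 (monicXn _ N))) => /(congr1 (fun P : {poly {mpoly R[n]}} => P`_0)).
rewrite [LHS]coef0M [RHS]coefMX eqxx coef0_dilate => /eqP.
rewrite mulf_eq0 mpolyC_eq0 (negPf nzu) /= => /eqP g0.
exists (drop_poly 1 g); rewrite def_w exprS mulrA; congr (_ * _).
rewrite -{1}(poly_take_drop 1 g) /take_poly poly_def big_ord1 g0.
by rewrite scale0r add0r.
Qed.

Lemma pihomog_vanishes N f k : vanishes N f -> (k < N)%N -> pihomog mdeg k f = 0.
Proof. by move=> [g def_f] lt_kN; rewrite -coef_dilate def_f coefMXn lt_kN. Qed.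

Lemma truncate_approx N f g : (msize g <= N)%N -> vanishes N (g - f) -> g = truncate N f.
Proof.
move=> szg van_gf; rewrite [LHS](pihomog_partitionE szg); apply: eq_bigr => k _.
by apply/eqP; rewrite -subr_eq0 -pihomogB (pihomog_vanishes van_gf).
Qed.

Lemma mcoeff0_horner (P : {poly {mpoly R[n]}}) y :
  P.[y]@_0%MM = (map_poly (mcoeff 0%MM) P).[y@_0%MM].
Proof. by rewrite horner_map. Qed.

Lemma vanishes_prod_roots N (ys : seq {mpoly R[n]}) (P : {poly {mpoly R[n]}}) x :
  size P = (size ys).+1 -> uniq [seq y@_0%MM | y <- ys] ->
  (forall y, y \in ys -> vanishes N P.[y]) ->
  vanishes N (P.[x] - lead_coef P * \prod_(y <- ys) (x - y)).
Proof.
elim: ys P => [|y ys IH] P szP /=.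
  move=> _ _; rewrite big_nil mulr1 (size1_polyC (eq_leq szP)) hornerC lead_coefC.
  by rewrite subrr; apply: vanishes0r.
case/andP=> y_ys uys vanP; have szPy : (size P.[y]%:P < size P)%N.
  by rewrite szP ltnS size_polyC; case: eqP.
have /factor_theorem[q def_q] : root (P - P.[y]%:P) y.
  by rewrite rootE !hornerE subrr.
have szP' : size (P - P.[y]%:P) = size P by rewrite size_polyDl ?size_polyN.
have lead_q : lead_coef q = lead_coef P.
  by rewrite -(lead_coef_Mmonic q (monicXsubC y)) -def_q lead_coefDl ?size_polyN.
have nzq : q != 0.
  by apply/eqP => q0; move: szP'; rewrite def_q q0 mul0r size_poly0 szP.
have szq : size q = (size ys).+1.
  by move: szP'; rewrite def_q size_Mmonic ?monicXsubC // size_XsubC addn2 szP => -[].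
have hornerP z : P.[z] = q.[z] * (z - y) + P.[y].
  have := congr1 (horner_eval z) def_q.
  by rewrite /horner_eval !hornerE => /(canRL (subrK _)).
rewrite big_cons hornerP -lead_q.
have -> : forall A B C E F : {mpoly R[n]},
    A * B + C - E * (B * F) = (A - E * F) * B + C by move=> *; ring.
apply: vanishesD; last by apply: vanP; rewrite mem_head.
apply: vanishes_mulr; apply: IH => // y' ys_y'.
apply: (@vanishes_mul_unit _ (y' - y)).
  rewrite mcoeffB subr_eq0; apply: contraNneq y_ys => <-.
  by apply/mapP; exists y'.
rewrite mulrC -[_ * _](addrK P.[y]) -hornerP; apply: vanishesB; apply: vanP.
  by rewrite in_cons ys_y' orbT.
by rewrite mem_head.
Qed.

End Vanishes.

Section GeometricInverse.
Variables (K : fieldType) (n : nat).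
Implicit Types f g h : {mpoly K[n]}.

Definition geometric_inverse (N : nat) g : {mpoly K[n]} :=
  (g@_0%MM)^-1 *: \sum_(i < N) (1 - (g@_0%MM)^-1 *: g) ^+ i.

Lemma vanishes_geometric_inverse N g :
  g@_0%MM != 0 -> vanishes N (1 - g * geometric_inverse N g).
Proof.
move=> nzg; rewrite /geometric_inverse; set c := _^-1; set w := 1 - c *: g.
have -> : 1 - g * (c *: \sum_(i < N) w ^+ i) = w ^+ N.
  have -> : g * (c *: \sum_(i < N) w ^+ i) = (1 - w) * \sum_(i < N) w ^+ i.
    by rewrite /w subKr -scalerAr scalerAl.
  have -> : (1 - w) * \sum_(i < N) w ^+ i = 1 - w ^+ N.
    rewrite -[1 in RHS](expr1n _ N) subrXX; congr (_ * _).
    by apply: eq_bigr => i _; rewrite expr1n mul1r.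
  by rewrite subKr.
by apply/vanishesX/vanishes1P; rewrite mcoeffB mcoeff1 eqxx mcoeffZ mulVf ?subrr.
Qed.

Lemma quotient_truncate N f g h : f = g * h -> g@_0%MM != 0 -> (msize h <= N)%N ->
  h = truncate N (f * geometric_inverse N g).
Proof.
move=> -> nzg szh; apply: truncate_approx => //.
rewrite mulrAC -{1}[h]mul1r -mulrBl.
exact/vanishes_mulr/vanishes_geometric_inverse.
Qed.

End GeometricInverse.

(** * Newton iteration *)

Section Newton.
Variables (K : fieldType) (n : nat).
Implicit Types (E G H : {poly {mpoly K[n]}}) (y z w : {mpoly K[n]}).

Local Notation residue := (map_poly (mcoeff (0%MM : 'X_{1..n}))).

(* The second component approximates the inverse of E' at the first one. *)
Definition newton_step E (yz : {mpoly K[n]} * {mpoly K[n]}) : {mpoly K[n]} * {mpoly K[n]} :=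
  let y := yz.1 - E.[yz.1] * yz.2 in (y, yz.2 * (2%:R - yz.2 * E^`().[y])).

Definition newton_iter E (a : K) (t : nat) : {mpoly K[n]} * {mpoly K[n]} :=
  iter t (newton_step E) (a%:MP, ((residue E)^`().[a])^-1%:MP).

Lemma newton_step_vanishes E N y z : (0 < N)%N ->
  vanishes N E.[y] -> vanishes N (E^`().[y] * z - 1) ->
  let yz := newton_step E (y, z) in
  [/\ vanishes (N + N) E.[yz.1], vanishes (N + N) (E^`().[yz.1] * yz.2 - 1) &
      yz.1@_0%MM = y@_0%MM].
Proof.
move=> N_gt0 vanE vanE' /=; set y' := y - _.
have def_y' : y' - y = - (E.[y] * z) by rewrite /y' addrC addKr.
split.
- have [c] := horner_taylor2 E y (- (E.[y] * z)); rewrite -/y' => ->.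
  have -> : E.[y] + E^`().[y] * - (E.[y] * z) + c * (- (E.[y] * z)) ^+ 2 =
    (c * z ^+ 2) * (E.[y] * E.[y]) - E.[y] * (E^`().[y] * z - 1) by ring.
  exact: (vanishesB (vanishes_mull _ (vanishesM vanE vanE)) (vanishesM vanE vanE')).
- have van_y' : vanishes N (E^`().[y'] * z - 1).
    have -> : E^`().[y'] * z - 1 = (E^`().[y'] - E^`().[y]) * z + (E^`().[y] * z - 1).
      by ring.
    apply: vanishesD vanE'; apply: vanishes_mulr.
    apply: vanishes_divides (divides_horner_sub _ _ _) _.
    by rewrite def_y'; apply/vanishesN/vanishes_mulr.
  have -> : E^`().[y'] * (z * (2%:R - z * E^`().[y'])) - 1 =
    - ((E^`().[y'] * z - 1) * (E^`().[y'] * z - 1)) by ring.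
  exact: (vanishesN (vanishesM van_y' van_y')).
apply/eqP; rewrite -subr_eq0 -mcoeffB def_y'; apply/eqP/vanishes1P/vanishesN.
exact: vanishes_leq N_gt0 (vanishes_mulr _ vanE).
Qed.

Lemma newton_iter_vanishes E (a : K) t :
  root (residue E) a -> ~~ root (residue E)^`() a ->
  let yz := newton_iter E a t in
  [/\ vanishes (2 ^ t) E.[yz.1], vanishes (2 ^ t) (E^`().[yz.1] * yz.2 - 1) &
      yz.1@_0%MM = a].
Proof.
move=> Ea E'a; elim: t => [|t].
  rewrite /=; split; last by rewrite mcoeffC eqxx mulr1.
    by apply/vanishes1P; rewrite mcoeff0_horner mcoeffC eqxx mulr1; apply/eqP.
  apply/vanishes1P; rewrite mcoeffB mulrC mcoeffCM mcoeff0_horner mcoeffC mcoeff1 eqxx.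
  by rewrite mulr1 deriv_map mulVf ?subrr // -deriv_map.
rewrite /newton_iter iterS -/(newton_iter E a t).
case: (newton_iter E a t) => y z [vanE vanE' ya].
have := newton_step_vanishes (expn_gt0 2 t) vanE vanE'.
by rewrite expnS mul2n -addnn ya.
Qed.

Lemma vanishes_root_unique E N y w :
  ~~ root (residue E)^`() w@_0%MM -> y@_0%MM = w@_0%MM ->
  vanishes N E.[y] -> vanishes N E.[w] -> vanishes N (y - w).
Proof.
move=> E'w eq_yw vanEy vanEw; have [c] := horner_taylor2 E w (y - w).
rewrite addrC subrK => def_Ey.
apply: (@vanishes_mul_unit _ _ _ (E^`().[w] + c * (y - w))).
  have /vanishes1P/(vanishes_mull c)/vanishes1P : (y - w)@_0%MM = 0.
    by rewrite mcoeffB eq_yw subrr.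
  by rewrite mcoeffD => ->; rewrite addr0 mcoeff0_horner -deriv_map.
have -> : (E^`().[w] + c * (y - w)) * (y - w) = E.[y] - E.[w] by rewrite def_Ey; ring.
exact: (vanishesB vanEy vanEw).
Qed.

(* The iterates for E converge to the root of G above a, whose existence is
   granted by the iteration for G, because simple roots lift uniquely. *)
Lemma newton_iter_nderivn_expM G H m (a : K) t (E := (G ^+ m * H)^`N(m.-1)) :
  m%:R != 0 :> K -> root (residue G) a -> ~~ root (residue G)^`() a ->
  ~~ root (residue H) a ->
  let y := (newton_iter E a t).1 in vanishes (2 ^ t) G.[y] /\ y@_0%MM = a.
Proof.
move=> nzm Ga G'a Ha y; have m_gt0 : (0 < m)%N by case: (m) nzm; rewrite ?eqxx.
have div_E w : divides G.[w] E.[w] by apply: divides_nderivn_expM; rewrite prednK.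
have [van_w _ wa] := newton_iter_vanishes t Ga G'a.
set w := (newton_iter G a t).1 in van_w wa.
have residueE : residue E = (residue G ^+ m * residue H)^`N(m.-1).
  by rewrite /E -nderivn_map rmorphM rmorphXn.
have E'a : ~~ root (residue E)^`() a by rewrite residueE simple_root_nderivn_expM.
have Ea : root (residue E) a.
  have [|c def_E] := @divides_nderivn_expM _ (residue G) (residue H) a m m.-1.
    by rewrite prednK.
  by rewrite residueE rootE def_E (rootP Ga) mulr0.
have [van_y _ ya] := newton_iter_vanishes t Ea E'a.
have van_yw : vanishes (2 ^ t) (y - w).
  by apply: vanishes_root_unique van_y (vanishes_divides (div_E w) van_w); rewrite wa.
split; last exact: ya.
rewrite -(subrK G.[w] G.[y]); apply: vanishesD van_w.
exact: vanishes_divides (divides_horner_sub _ _ _) van_yw.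
Qed.

End Newton.

(** * Cost measures *)

Section AffineSubst.
Variables (R : comNzRingType) (n : nat) (v w : 'I_n -> R).

Definition affine_subst : {mpoly R[n]} -> {mpoly R[n]} :=
  mmap (@mpolyC n R) (fun j => (v j)%:MP + (w j)%:MP * 'X_j).

HB.instance Definition _ := GRing.RMorphism.on affine_subst.

Lemma affine_substC c : affine_subst c%:MP = c%:MP.
Proof. exact: mmapC. Qed.

Lemma affine_substX j : affine_subst 'X_j = (v j)%:MP + (w j)%:MP * 'X_j.
Proof. exact: mmapXU. Qed.

End AffineSubst.

Lemma msize_affine (R : nzRingType) n (a b : R) (j : 'I_n) :
  (msize (a%:MP_[n] + b%:MP * 'X_j)%R <= 2)%N.
Proof.
apply: leq_trans (msizeD_le _ _) _; rewrite geq_max msizeC mul_mpolyC.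
by rewrite (leq_trans (leq_b1 _)) // (leq_trans (msizeZ_le _ _)) // msizeX mdeg1.
Qed.

Lemma msize_affine_subst (R : idomainType) n (v w : 'I_n -> R) (f : {mpoly R[n]}) :
  (msize (affine_subst v w f) <= msize f)%N.
Proof. by apply: msize_subst_affine => j; apply: msize_affine. Qed.

Record cost_measure (K : fieldType) (n kappa : nat)
    (computable : {mpoly K[n]} -> nat -> Prop) : Prop := CostMeasure {
  overhead_gt0 : (0 < kappa)%N;
  computable_leq : forall f s t, (s <= t)%N -> computable f s -> computable f t;
  computable_const : forall c, computable c%:MP 1%N;
  computable_sum : forall N (f : 'I_N -> {mpoly K[n]}) s, (0 < s)%N ->
    (forall i, computable (f i) s) -> computable (\sum_i f i) (kappa * N.+1 * s)%N;
  computable_prod : forall N (f : 'I_N -> {mpoly K[n]}) s, (0 < s)%N ->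
    (forall i, computable (f i) s) -> computable (\prod_i f i) (kappa * N.+1 * s)%N;
  computable_affine_subst : forall v w f s, (0 < s)%N ->
    computable f s -> computable (affine_subst v w f) (kappa * s)%N
}.

Lemma interpolation (K : closedFieldType) (n N : nat) :
  exists (t : 'I_N -> K) (w : 'I_N -> 'I_N -> K),
    forall P : {poly {mpoly K[n]}}, (size P <= N)%N -> forall k : 'I_N,
      P`_k = \sum_l w k l *: P.[(t l)%:MP].
Proof.
have [s szs us] := closed_field_points K N.
pose V := Vandermonde N (\row_(l < N) s`_l).
have unitV : V \in unitmx.
  rewrite unitmxE det_Vandermonde unitfE; apply/prodf_neq0 => i _.
  apply/prodf_neq0 => j lt_ij; rewrite !mxE subr_eq0 nth_uniq ?szs //.
  by rewrite eq_sym ltn_eqF.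
exists (fun l => s`_l), (fun k l => invmx V l k) => P szP k.
under eq_bigr => l _ do rewrite (horner_coef_wide _ szP) scaler_sumr.
rewrite exchange_big /=.
have orthogonality (i : 'I_N) :
    \sum_l invmx V l k *: (P`_i * (s`_l)%:MP ^+ i) = (i == k)%:R *: P`_i.
  transitivity ((V *m invmx V) i k *: P`_i); last by rewrite mulmxV // mxE.
  rewrite mxE scaler_suml; apply: eq_bigr => l _.
  by rewrite [V i l]mxE mxE -!mul_mpolyC -rmorphXn /= mpolyCM; ring.
rewrite (eq_bigr _ (fun i _ => orthogonality i)) (bigD1 k) //= eqxx scale1r.
by rewrite big1 ?addr0 // => i /negPf->; rewrite scale0r.
Qed.

(** * Levels of cost *)

Lemma leq_wexp2r (m n e : nat) : (m <= n)%N -> (m ^ e <= n ^ e)%N.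
Proof. by move=> le_mn; case: e => // e; rewrite leq_exp2r. Qed.

Section Levels.
Variables (K : closedFieldType) (n kappa : nat) (computable : {mpoly K[n]} -> nat -> Prop).
Hypothesis cost : cost_measure kappa computable.
Variables (D s : nat).
Hypothesis s_gt0 : (0 < s)%N.
Implicit Types (f g h y z : {mpoly K[n]}) (E P : {poly {mpoly K[n]}}) (k : nat).

Local Notation base := (kappa * D.+3)%N.

(* The degree is bounded along with the cost because it determines the number of
   nodes needed to extract homogeneous components by interpolation. *)
Definition level k f : Prop :=
  computable f (base ^ k * s) /\ (msize f <= D.+2 ^ k.+1)%N.

Let kappa_gt0 : (0 < kappa)%N. Proof. exact: overhead_gt0 cost. Qed.
Let base_gt0 : (0 < base)%N. Proof. by rewrite muln_gt0 kappa_gt0. Qed.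
Let size_gt0 k : (0 < base ^ k * s)%N. Proof. by rewrite muln_gt0 expn_gt0 base_gt0. Qed.

Lemma level_leq k l f : (k <= l)%N -> level k f -> level l f.
Proof.
move=> le_kl [comp_f szf]; split.
  by apply: (computable_leq cost _ comp_f); rewrite leq_mul // leq_pexp2l.
by apply: leq_trans szf _; rewrite leq_pexp2l.
Qed.

Lemma level0P f : level 0 f <-> computable f s /\ (msize f <= D.+2)%N.
Proof. by rewrite /level mul1n expn1. Qed.

Lemma level_const k c : level k c%:MP.
Proof.
apply: (@level_leq 0) => //; split; last by rewrite msizeC; case: eqP.
by apply: (computable_leq cost _ (computable_const cost c)); rewrite mul1n.
Qed.

Lemma level_sum k m N (f : 'I_N -> {mpoly K[n]}) : (N <= D.+2 ^ m)%N ->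
  (forall i, level k (f i)) -> level (k + m.+1) (\sum_i f i).
Proof.
move=> leN level_f; have comp_f i := proj1 (level_f i); split; last first.
  apply: msize_sum_leq => i _; apply: leq_trans (proj2 (level_f i)) _.
  by rewrite leq_pexp2l // ltnS leq_addr.
apply: (computable_leq cost _ (computable_sum cost (size_gt0 k) comp_f)).
rewrite [(k + _)%N]addnC expnD -[leqRHS]mulnA leq_mul2r; apply/orP; right.
have leN1 : (N.+1 <= D.+3 ^ m.+1)%N.
  apply: (@leq_trans (D.+3 ^ m).+1).
    by rewrite ltnS; apply: leq_trans leN (leq_wexp2r _ _).
  by rewrite expnS mulSn -addn1 leq_add2l muln_gt0 expn_gt0.
by rewrite expnMn leq_mul // [(kappa ^ _)%N]expnS leq_pmulr // expn_gt0 kappa_gt0.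
Qed.

Lemma level_prod k N (f : 'I_N -> {mpoly K[n]}) : (N <= D.+2)%N ->
  (forall i, level k (f i)) -> level k.+1 (\prod_i f i).
Proof.
move=> leN level_f; have comp_f i := proj1 (level_f i); split.
  apply: (computable_leq cost _ (computable_prod cost (size_gt0 k) comp_f)).
  by rewrite expnS -[leqRHS]mulnA leq_mul2r leq_mul2l ltnS leN !orbT.
set d := (D.+2 ^ k.+1)%N; have d_gt0 : (0 < d)%N by rewrite expn_gt0.
apply: leq_trans (@msize_prod_leq _ _ _ _ _ _ (fun=> d.-1) _) _ => [i _|].
  by rewrite prednK //; case: (level_f i).
rewrite sum_nat_const card_ord [in leqRHS]expnS -/d -(prednK d_gt0) /= mulnS.
by rewrite -add1n leq_add // leq_mul2r leN orbT.
Qed.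

Lemma level_add i j k f g : (i.+1 < k)%N -> (j.+1 < k)%N ->
  level i f -> level j g -> level k (f + g).
Proof.
case: k => [//|[//|k]] le_ik le_jk level_f level_g.
have := @level_sum k 1 2 (fun l => if l == ord0 then f else g).
rewrite big_ord_recl big_ord1 /= addn2; apply=> // l.
by case: ifP => _; [apply: level_leq level_f | apply: level_leq level_g].
Qed.

Lemma level_mul i j k f g : (i < k)%N -> (j < k)%N ->
  level i f -> level j g -> level k (f * g).
Proof.
case: k => // k le_ik le_jk level_f level_g.
have := @level_prod k 2 (fun l => if l == ord0 then f else g).
rewrite big_ord_recl big_ord1 /=; apply=> // l.
by case: ifP => _; [apply: level_leq level_f | apply: level_leq level_g].
Qed.

Lemma level_exp i k m f : (m <= D.+2)%N -> (i < k)%N -> level i f -> level k (f ^+ m).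
Proof.
case: k => // k lem le_ik level_f; rewrite -[m]card_ord -prodr_const.
by apply: level_prod => // _; apply: level_leq level_f.
Qed.

Lemma level_scale i k c f : (i < k)%N -> level i f -> level k (c *: f).
Proof.
move=> lt_ik level_f; rewrite -mul_mpolyC.
exact: (level_mul lt_ik lt_ik (level_const i c) level_f).
Qed.

Lemma level_opp i k f : (i < k)%N -> level i f -> level k (- f).
Proof. by rewrite -scaleN1r; apply: level_scale. Qed.

Lemma level_sub i j k f g : (i.+1 < k)%N -> (j.+2 < k)%N ->
  level i f -> level j g -> level k (f - g).
Proof.
by move=> lt_ik lt_jk level_f level_g; apply: (level_add lt_ik lt_jk) => //;
   apply: level_opp level_g.
Qed.

Lemma level_affine_subst i k v w f : (i < k)%N -> level i f -> level k (affine_subst v w f).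
Proof.
move=> lt_ik level_f; apply: (level_leq lt_ik); have [comp_f szf] := level_f; split.
  apply: (computable_leq cost _ (computable_affine_subst cost v w (size_gt0 i) comp_f)).
  by rewrite expnS -[leqRHS]mulnA leq_mul2r leq_pmulr ?orbT.
apply: leq_trans (msize_affine_subst _ _ _) (leq_trans szf _).
by rewrite leq_pexp2l.
Qed.

Lemma level_coef k m P : (size P <= D.+2 ^ m)%N ->
  (forall t, level k P.[t%:MP]) -> forall i, level (k + m.+2) P`_i.
Proof.
move=> szP level_P i; have [lt_i|le_i] := ltnP i (D.+2 ^ m); last first.
  by rewrite nth_default ?(leq_trans szP) // -mpolyC0; apply: level_const.
have [t [w def_P]] := interpolation K n (D.+2 ^ m).
rewrite (def_P P szP (Ordinal lt_i)) addnS -addSn; apply: level_sum => // l.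
exact: level_scale (level_P _).
Qed.

Lemma level_horner k E y : (size E <= D.+2)%N ->
  (forall i, level k E`_i) -> level k y -> level (k + 4) E.[y].
Proof.
move=> szE level_E level_y; rewrite horner_coef [(k + 4)%N](addnA k 2 2).
apply: level_sum => [|i]; first by rewrite expn1.
rewrite addn2; apply: (level_mul (i := k) (j := k.+1)) => //.
by apply: level_exp level_y; rewrite // (leq_trans (ltnW (ltn_ord i))).
Qed.

Lemma level_truncate k f : level k f -> level (2 * k + 6) (truncate D.+1 f).
Proof.
move=> level_f; rewrite (_ : 2 * k + 6 = k.+1 + k.+3 + 2)%N; last by lia.
apply: level_sum => [|i]; first by rewrite expn1.
rewrite -coef_dilate; apply: level_coef => [|t]; first by rewrite size_dilate; case: level_f.
rewrite (_ : _.[_] = affine_subst (fun=> 0) (fun=> t) f); first exact: level_affine_subst level_f.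
by rewrite horner_line; apply: eq_mmap => // j; rewrite mpolyC0 mulrC.
Qed.

Lemma level_quotient f g h : f = g * h -> f != 0 -> (msize f <= D.+1)%N ->
  g@_0%MM != 0 -> level 0 f -> level 0 g -> level 24 h.
Proof.
move=> def_f nzf szf nzg level_f level_g.
have szh : (msize h <= D.+1)%N.
  by apply: leq_trans szf; apply: (msize_dvd_leq (h := g)); rewrite // mulrC.
rewrite (quotient_truncate def_f nzg szh); apply: (@level_truncate 9).
apply: (level_mul (i := 0) (j := 8)) => //; apply: (level_scale (i := 7)) => //.
apply: (@level_sum 5 1) => [|i]; first by rewrite expn1.
apply: (level_exp (i := 4)) => //; first exact: leq_trans (ltnW (ltn_ord i)) _.
apply: (level_sub (i := 0) (j := 1)) => //; last exact: level_scale level_g.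
by rewrite -mpolyC1; apply: level_const.
Qed.

Lemma level_newton_step E k y z : (size E <= D.+2)%N -> (forall i, level k E`_i) ->
  level k.+1 y -> level k.+1 z ->
  level (k.+1 + 17) (newton_step E (y, z)).1 /\ level (k.+1 + 17) (newton_step E (y, z)).2.
Proof.
move=> szE level_E level_y level_z /=; set y' := y - _ * z.
have level_Ey : level (k + 5) E.[y].
  rewrite addnS -addSn; apply: level_horner => // i.
  exact: level_leq (level_E i).
have level_y' : level (k + 9) y'.
  apply: level_sub level_y (level_mul (k := k + 6) _ _ level_Ey level_z); lia.
have level_E'y : level (k + 13) E^`().[y'].
  rewrite (addnA k 9 4); apply: level_horner level_y' => [|i].
    exact: leq_trans (size_poly _ _) (leq_trans (leq_pred _) szE).
  by rewrite coef_deriv -scaler_nat; apply: level_scale (level_E _); lia.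
split; first by apply: level_leq level_y'; lia.
apply: (level_mul (j := k + 17) _ _ level_z); [lia | lia |].
rewrite -mpolyC_nat; apply: (level_sub (i := 0) (j := k + 14)); [lia | lia | |].
  exact: level_const.
by apply: level_mul level_z level_E'y; lia.
Qed.

Lemma level_newton_iter E a k t : (size E <= D.+2)%N -> (forall i, level k E`_i) ->
  level (k.+1 + 17 * t) (newton_iter E a t).1.
Proof.
move=> szE level_E; suff [] : level (k.+1 + 17 * t) (newton_iter E a t).1 /\
  level (k.+1 + 17 * t) (newton_iter E a t).2 by [].
elim: t => [|t [level_y level_z]] /=; first by split; apply: level_const.
rewrite mulnS addnCA addnC; case: (newton_iter E a t) level_y level_z => y z.
apply: (@level_newton_step E (k + 17 * t)) => // i.
exact: level_leq (leq_addr _ _) (level_E i).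
Qed.

End Levels.

(** * Extraction of a separable factor *)

Section CoefTranslate.
Variables (R : idomainType) (n : nat) (b : 'I_n -> R).

Definition total_degree_leq (d : nat) (P : {poly {mpoly R[n]}}) : Prop :=
  forall k, (msize P`_k <= d.+1 - k)%N.

Lemma total_degree_leqM d e P Q :
  total_degree_leq d P -> total_degree_leq e Q -> total_degree_leq (d + e) (P * Q).
Proof.
move=> degP degQ k; rewrite coefM; apply: msize_sum_leq => i _.
have [->|nzP] := eqVneq P`_i 0; first by rewrite mul0r msize0.
have [->|nzQ] := eqVneq Q`_(k - i) 0; first by rewrite mulr0 msize0.
have := degP i; have := degQ (k - i)%N; rewrite msizeM //.
rewrite (mpolySpred _ nzP) (mpolySpred _ nzQ); have := ltn_ord i.
by move: (msize P`_i).-1 (msize Q`_(k - i)).-1 (nat_of_ord i) => x y l; lia.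
Qed.

Lemma total_degree_leq_linear j :
  total_degree_leq 1 (('X_j)%:P + (b j)%:MP%:P * 'X).
Proof.
move=> k; rewrite coefD coefC coefCM coefX; case: k => [|[|k]] /=.
- by rewrite mulr0 addr0 msizeX mdeg1.
- by rewrite add0r mulr1 msizeC leq_b1.
- by rewrite mulr0 addr0 msize0.
Qed.

Lemma msize_coef_translate (f : {mpoly R[n]}) k :
  (msize (translate (fun j => (b j)%:MP) f)`_k <= msize f - k)%N.
Proof.
rewrite /translate /line /mmap coef_sum big_seq; apply: msize_sum_leq => m suppm.
rewrite /= coefCM mul_mpolyC; apply: leq_trans (msizeZ_le _ _) _.
apply: (@leq_trans ((mdeg m).+1 - k)); last by rewrite leq_sub2r // msize_mdeg_lt.
have deg1 : total_degree_leq 0 1 by case=> [|l]; rewrite coef1 ?msize1 ?msize0.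
move: k; rewrite -/(total_degree_leq _ _) /mmap1 mdegE.
elim/big_rec2: _ => // j d P _; apply: total_degree_leqM.
elim: (m j) => // l IH; rewrite exprS -add1n.
exact: (total_degree_leqM (total_degree_leq_linear j) IH).
Qed.

End CoefTranslate.

Lemma residue_translate (R : comNzRingType) n (b : 'I_n -> R) (f : {mpoly R[n]}) :
  map_poly (mcoeff 0%MM) (translate (fun j => (b j)%:MP) f) = central_line b f.
Proof.
apply: map_line => [c|j|j] /=; rewrite ?mcoeffC ?eqxx ?mulr1 //.
by rewrite mcoeffX mnm1_eq0.
Qed.

Section SeparableFactor.
Variables (K : closedFieldType) (n D m t : nat) (beta : 'I_n -> K) (C g R : {mpoly K[n]}).

Local Notation U := (central_line beta).
Local Notation T := (translate (fun j => (beta j)%:MP)).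
Local Notation E := ((T C)^`N(m.-1)).

Hypotheses (def_C : C = g ^+ m * R) (nzm : m%:R != 0 :> K) (nzg : g != 0).
Hypothesis size_Ug : size (U g) = msize g.
Hypothesis simple_Ug : forall a, root (U g) a -> ~~ root (U g)^`() a.
Hypothesis UR_nonroot : forall a, root (U g) a -> ~~ root (U R) a.
Hypotheses (szC : (msize C <= D.+1)%N) (szg : (msize g <= D.+1)%N).
Hypothesis lt_D : (D < 2 ^ t)%N.

Lemma newton_iter_translate (a : K) : root (U g) a ->
  let y := (newton_iter E a t).1 in vanishes (2 ^ t) (T g).[y] /\ y@_0%MM = a.
Proof.
move=> ra; rewrite def_C rmorphM rmorphXn.
apply: newton_iter_nderivn_expM; rewrite ?residue_translate //.
  exact: simple_Ug.
exact: UR_nonroot.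
Qed.

Lemma size_translate : size (T g) = msize g.
Proof.
apply/eqP; rewrite eqn_leq size_line -{1}size_Ug -residue_translate.
exact: size_poly.
Qed.

Lemma lead_coef_translate : exists c, lead_coef (T g) = c%:MP.
Proof.
exists (lead_coef (T g))@_0%MM; apply: msize1_polyC; rewrite lead_coefE size_translate.
by apply: leq_trans (msize_coef_translate _ _ _) _; rewrite leq_subLR addn1 leqSpred.
Qed.

(* On the line through x in direction beta, g is c * \prod_a (y - y_a); at y = 0
   this is g(x), and only the terms of degree at most D matter. *)
Lemma factor_newton_product : exists c (rs : seq K), (size rs < msize g)%N /\
  g = truncate D.+1 (c%:MP * \prod_(a <- rs) - (newton_iter E a t).1).
Proof.
have [rs def_Ug] := closed_field_poly_normal (U g).
have nz_lead : lead_coef (U g) != 0.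
  by rewrite lead_coef_eq0 -size_poly_eq0 size_Ug msize_poly_eq0.
have size_rs : msize g = (size rs).+1.
  by rewrite -size_Ug def_Ug size_scale // size_prod_XsubC.
have root_rs a : (a \in rs) = root (U g) a by rewrite def_Ug rootZ // root_prod_XsubC.
have uniq_rs : uniq rs.
  rewrite -separable_prod_XsubC -(eqp_separable (eqp_scale _ nz_lead)) -def_Ug.
  by rewrite unlock; apply: Pdiv.ClosedField.root_coprimep => a; apply: simple_Ug.
pose ys := [seq (newton_iter E a t).1 | a <- rs].
have residue_ys : [seq y@_0%MM | y <- ys] = rs.
  rewrite -map_comp -[RHS]map_id; apply/eq_in_map => a; rewrite root_rs /=.
  by case/newton_iter_translate.
have [c lead_c] := lead_coef_translate.
exists c, rs; split; first by rewrite size_rs.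
apply: truncate_approx => //; apply: vanishes_leq lt_D _; rewrite -lead_c.
have -> : \prod_(a <- rs) - (newton_iter E a t).1 = \prod_(y <- ys) (0 - y).
  by rewrite big_map; apply: eq_bigr => a _; rewrite sub0r.
rewrite -{1}[g](translate_coef0 (fun j => (beta j)%:MP)) -horner_coef0.
apply: vanishes_prod_roots; rewrite ?residue_ys //.
  by rewrite size_map -size_rs size_translate.
by move=> y /mapP[a]; rewrite root_rs => /newton_iter_translate[van_y _] ->.
Qed.

Variables (kappa s : nat) (computable : {mpoly K[n]} -> nat -> Prop).
Hypothesis cost : cost_measure kappa computable.
Hypothesis s_gt0 : (0 < s)%N.

Local Notation level := (level kappa computable D s).

Lemma level_coef_translate i : level 0 C -> level 4 (T C)`_i.
Proof.
move=> level_C; apply: (@level_coef _ _ _ _ cost _ _ s_gt0 1 1) => [|a].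
  by rewrite expn1; apply: leq_trans (size_line _ _ _ _) (leqW szC).
rewrite (_ : _.[_] = affine_subst (fun j => beta j * a) (fun=> 1) C).
  exact: level_affine_subst level_C.
rewrite horner_line; apply: eq_mmap => // j.
by rewrite mpolyC1 mul1r mpolyCM addrC.
Qed.

Lemma level_separable_factor : level 0 C -> level (34 * t + 24) g.
Proof.
move=> level_C; have level_E i : level 5 E`_i.
  rewrite coef_nderivn -scaler_nat.
  exact: (level_scale cost s_gt0 _ _ (level_coef_translate _ level_C)).
have szE : (size E <= D.+2)%N.
  apply: leq_trans (size_poly _ _) (leq_trans (leq_subr _ _) _).
  exact: leq_trans (size_line _ _ _ _) (leqW szC).
have [c [rs [lt_rs ->]]] := factor_newton_product.
rewrite (_ : 34 * t + 24 = 2 * (17 * t + 9) + 6)%N; last by lia.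
apply: (level_truncate cost s_gt0); rewrite addnS.
apply: (level_mul cost s_gt0 (i := 0) (j := 17 * t + 8)) => //; first exact: level_const.
rewrite addnS (big_nth 0) big_mkord; apply: (level_prod cost s_gt0) => // [|i].
  exact: leq_trans (ltnW lt_rs) (leqW szg).
apply: (level_opp cost s_gt0 (i := 6 + 17 * t)) => //; first by lia.
exact: level_newton_iter.
Qed.

End SeparableFactor.

(** * Inseparable multiplicities *)

Section PowerSubst.
Variables (R : comNzRingType) (n q : nat).

Definition power_subst : {mpoly R[n]} -> {mpoly R[n]} :=
  mmap (@mpolyC n R) (fun j => 'X_j ^+ q).

HB.instance Definition _ := GRing.RMorphism.on power_subst.

Lemma power_substC c : power_subst c%:MP = c%:MP.
Proof. exact: mmapC. Qed.

Lemma power_substX j : power_subst 'X_j = 'X_j ^+ q.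
Proof. exact: mmapXU. Qed.

End PowerSubst.

Lemma closed_field_nth_root (K : closedFieldType) q (x : K) :
  (0 < q)%N -> exists y, y ^+ q = x.
Proof.
move=> q_gt0; have /closed_rootP[y] : size ('X^q - x%:P) != 1%N.
  by rewrite size_XnsubC // eqSS -lt0n.
by rewrite rootE !hornerE subr_eq0 => /eqP; exists y.
Qed.

Section Twist.
Variables (p : nat) (K : closedFieldType) (charK : p \in [pchar K]) (n e : nat).
Implicit Types f g : {mpoly K[n]}.

Local Notation q := (p ^ e)%N.
Local Notation frob := (frobenius_iter charK e).

Let q_gt0 : (0 < q)%N.
Proof. by rewrite expn_gt0 prime_gt0 ?(pcharf_prime charK). Qed.

Definition twist : {mpoly K[n]} -> {mpoly K[n]} := map_mpoly frob.

HB.instance Definition _ := GRing.RMorphism.on twist.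

Lemma power_subst_twist f : power_subst q (twist f) = f ^+ q.
Proof.
have charM := mpoly_pchar n charK.
apply: (@mpoly_rmorph_ext _ _ _ (power_subst q \o twist) (frobenius_iter charM e))
  => [c|j] /=.
  by rewrite /twist map_mpolyC power_substC /= /frobenius_iter rmorphXn.
by rewrite /twist map_mpolyX power_substX.
Qed.

Lemma msize_twist f : msize (twist f) = msize f.
Proof. exact/msize_map_mpoly/fmorph_inj. Qed.

Lemma central_line_twist (b : 'I_n -> K) f :
  central_line (frob \o b) (twist f) = map_poly frob (central_line b f).
Proof.
rewrite /central_line /twist line_map_mpoly; apply/esym/map_line => // j.
exact: rmorph0.
Qed.

Lemma root_map_frobenius (P : {poly K}) a : root (map_poly frob P) a ->
  exists2 b, a = frob b & root P b.
Proof.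
have [b def_a] := closed_field_nth_root a q_gt0.
rewrite -{1}def_a -[b ^+ q]/(frob b) fmorph_root => rb.
by exists b.
Qed.

Lemma power_subst_affine_subst (v w v' w' : 'I_n -> K) f :
  (forall j, v j = frob (v' j)) -> (forall j, w j = frob (w' j)) ->
  power_subst q (affine_subst v w f) = affine_subst v' w' (power_subst q f).
Proof.
move=> def_v def_w.
have charM := mpoly_pchar n charK.
apply: (@mpoly_rmorph_ext _ _ _ (power_subst q \o affine_subst v w)
  (affine_subst v' w' \o power_subst q)) => [c|j] /=.
  by rewrite affine_substC !power_substC affine_substC.
rewrite affine_substX power_substX rmorphXn /= affine_substX.
rewrite -[RHS]/(frobenius_iter charM e _) rmorphD rmorphM /=.
rewrite rmorphD rmorphM /= !power_substC power_substX def_v def_w.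
by rewrite /frobenius_iter !rmorphXn.
Qed.

Lemma power_subst_cost kappa (computable : {mpoly K[n]} -> nat -> Prop) :
  cost_measure kappa computable ->
  cost_measure kappa (fun f => computable (power_subst q f)).
Proof.
move=> cost; split=> [|f s t|c|N f s s_gt0 comp_f|N f s s_gt0 comp_f|v w f s s_gt0 comp_f].
- exact: overhead_gt0 cost.
- exact: (computable_leq cost).
- by rewrite power_substC; apply: (computable_const cost).
- by rewrite rmorph_sum; apply: (computable_sum cost).
- by rewrite rmorph_prod; apply: (computable_prod cost).
have /fin_all_exists[v' def_v] j : exists y, v j = frob y.
  by have [y <-] := closed_field_nth_root (v j) q_gt0; exists y.
have /fin_all_exists[w' def_w] j : exists y, w j = frob y.
  by have [y <-] := closed_field_nth_root (w j) q_gt0; exists y.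
rewrite (power_subst_affine_subst _ def_v def_w).
exact: (computable_affine_subst cost).
Qed.

(* With C := u * twist (g ^+ m * R) one has C(x^q) = B; the separable case applies
   to C when a polynomial h is charged the cost of h(x^q). *)
Lemma computable_inseparable_factor (kappa D s t m : nat) (beta : 'I_n -> K)
    (computable : {mpoly K[n]} -> nat -> Prop) (u : K) (g R B : {mpoly K[n]}) :
  cost_measure kappa computable -> (0 < s)%N -> (D < 2 ^ t)%N ->
  B = u%:MP * (g ^+ m * R) ^+ q -> B != 0 -> (msize B <= D.+1)%N -> ~~ (p %| m)%N ->
  size (central_line beta g) = msize g ->
  (forall a, root (central_line beta g) a -> ~~ root (central_line beta g)^`() a) ->
  (forall a, root (central_line beta g) a -> ~~ root (central_line beta R) a) ->
  computable B s ->
  computable (g ^+ q) ((kappa * D.+3) ^ (34 * t + 24) * s)%N.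
Proof.
move=> cost s_gt0 lt_D def_B nzB szB ndvd size_Ug simple_Ug UR_nonroot comp_B.
have m_gt0 : (0 < m)%N by case: m ndvd {def_B}; rewrite ?dvdn0.
have nzu : u != 0 by apply: contraNneq nzB => u0; rewrite def_B u0 mul0r.
have nzgR : g ^+ m * R != 0.
  by apply: contraNneq nzB => gR0; rewrite def_B gR0 expr0n eqn0Ngt q_gt0 mulr0.
have nzg : g != 0.
  by apply: contraNneq nzgR => g0; rewrite g0 expr0n eqn0Ngt m_gt0 mul0r.
have szgR : (msize (g ^+ m * R)%R <= D.+1)%N.
  apply: leq_trans szB; apply: msize_dvd_leq nzB.
  by rewrite def_B -{1}(prednK q_gt0) exprS mulrCA.
have szg : (msize g <= D.+1)%N.
  apply: leq_trans szgR; apply: msize_dvd_leq nzgR.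
  by rewrite -{1}(prednK m_gt0) exprS -mulrA.
pose C := u%:MP * twist (g ^+ m * R).
have szC : (msize C <= D.+1)%N by rewrite /C mul_mpolyC msizeZ // msize_twist.
have comp_C : computable (power_subst q C) s.
  by rewrite rmorphM /= power_substC power_subst_twist -def_B.
rewrite -power_subst_twist.
have [] // := @level_separable_factor _ _ D m t (frob \o beta) C (twist g)
  (u%:MP * twist R) _ _ _ _ _ _ szC _ lt_D _ _ _ (power_subst_cost cost) s_gt0.
- by rewrite /C rmorphM rmorphXn /= mulrCA.
- by rewrite -(dvdn_pcharf charK).
- by rewrite -msize_poly_eq0 msize_twist msize_poly_eq0.
- by rewrite central_line_twist size_map_poly msize_twist.
- rewrite central_line_twist => _ /root_map_frobenius[b -> rb].
  by rewrite deriv_map fmorph_root; apply: simple_Ug.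
- rewrite central_line_twist => _ /root_map_frobenius[b -> rb].
  rewrite rmorphM /= central_line_twist rootM negb_or fmorph_root UR_nonroot // andbT.
  by rewrite /central_line lineC rootC.
- by rewrite msize_twist.
by apply/level0P; rewrite leqW.
Qed.

End Twist.

Lemma central_line0 (R : comNzRingType) n (b : 'I_n -> R) (f : {mpoly R[n]}) :
  (central_line b f).[0] = f@_0%MM.
Proof.
rewrite /central_line horner0_line.
apply: (@mpoly_rmorph_ext _ _ _ (mmap idfun (fun=> 0)) (mcoeff 0%MM)) => [c|j] /=.
  by rewrite mmapC mcoeffC eqxx mulr1.
by rewrite mmapXU mcoeffX mnm1_eq0.
Qed.

(** * Increasing exponents *)

Section ValuesBelow.
Variables (r : nat) (e : 'I_r -> nat).

Definition values_below (x : nat) : nat := size (undup [seq y <- codom e | (y < x)%N]).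

Lemma values_below_lt (i : 'I_r) (s : seq nat) :
  (forall y, (y <= e i)%N -> y \in codom e -> y \in s) -> (values_below (e i) < size s)%N.
Proof.
move=> sub_s; apply: (@uniq_leq_size _ (e i :: undup [seq y <- codom e | (y < e i)%N])).
  by rewrite /= undup_uniq mem_undup mem_filter ltnn.
move=> y; rewrite in_cons mem_undup mem_filter.
by case/orP => [/eqP->|/andP[/ltnW le_y]]; apply: sub_s; rewrite ?codom_f.
Qed.

Lemma values_below_mono (i : 'I_r) x : (e i < x)%N -> (values_below (e i) < values_below x)%N.
Proof.
move=> lt_ix; apply: values_below_lt => y le_yi; rewrite mem_undup mem_filter => ->.
by rewrite andbT (leq_ltn_trans le_yi).
Qed.

Lemma values_below_num (i : 'I_r) : (values_below (e i) < num_values e)%N.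
Proof. by apply: values_below_lt => y _; rewrite mem_undup. Qed.

End ValuesBelow.

Section IncreasingExponents.
Variables (p : nat) (K : closedFieldType) (charK : p \in [pchar K]) (n r D t : nat).
Variables (beta : 'I_n -> K) (u : K) (f : {mpoly K[n]}) (h : 'I_r -> {mpoly K[n]}).
Variables (e j : 'I_r -> nat).

Hypotheses (lt_D : (D < 2 ^ t)%N) (nzu : u != 0) (szf : (msize f <= D.+1)%N).
Hypothesis def_f : f = u%:MP * \prod_k h k ^+ (p ^ e k * j k).
Hypothesis szh : forall k, (1 < msize (h k))%N.
Hypothesis ndvd : forall k, ~~ (p %| j k)%N.
Hypothesis separating : separating_line idfun (fun=> 0) beta h.

Let nzh k : h k != 0. Proof. by rewrite -msize_poly_eq0 -lt0n ltnW. Qed.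

Let j_gt0 k : (0 < j k)%N. Proof. by case: (j k) (ndvd k) => //; rewrite dvdn0. Qed.

Let pow_gt0 k : (0 < p ^ k)%N.
Proof. by rewrite expn_gt0 prime_gt0 ?(pcharf_prime charK). Qed.

Let nzf : f != 0.
Proof.
rewrite def_f mulf_neq0 ?mpolyC_eq0 //.
by apply/prodf_neq0 => k _; rewrite expf_neq0.
Qed.

Let r_leq : (r <= D)%N.
Proof.
rewrite -ltnS (leq_trans _ szf) //; apply: num_factors_ltn def_f nzf szh _ => k.
by rewrite muln_gt0 pow_gt0 j_gt0.
Qed.

Let msize_multiplicity k : (msize (h k ^+ (p ^ e k * j k))%R <= D.+1)%N.
Proof.
by apply: leq_trans szf; apply: msize_dvd_leq nzf; rewrite def_f (bigD1 k) //= mulrCA.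
Qed.

Let msize_power k : (msize (h k ^+ (p ^ e k))%R <= D.+1)%N.
Proof.
apply: leq_trans (msize_multiplicity k).
apply: (msize_dvd_leq (h := h k ^+ (p ^ e k * (j k).-1))); last by rewrite expf_neq0.
by rewrite -exprD -mulnS prednK.
Qed.

Let j_leq k : (j k <= D)%N.
Proof.
rewrite -ltnS (leq_trans _ (msize_multiplicity k)) //.
apply: leq_ltn_trans (msize_exp_gt _ (szh k)).
exact: leq_pmull.
Qed.

Definition lower_part i : {mpoly K[n]} :=
  \prod_(k | (e k < e i)%N) h k ^+ (p ^ e k * j k).

Definition upper_part i : {mpoly K[n]} :=
  \prod_(k | (k != i) && (e i <= e k)%N) h k ^+ (p ^ (e k - e i) * j k).

Lemma lower_upper_split i :
  f = lower_part i * (u%:MP * (h i ^+ j i * upper_part i) ^+ (p ^ e i)).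
Proof.
rewrite def_f (bigID (fun k => (e k < e i)%N)) /= mulrCA; congr (_ * (_ * _)).
rewrite (bigD1 i) ?ltnn //= exprMn -exprM mulnC; congr (_ * _).
rewrite /upper_part -prodrXl; apply: eq_big => [k|k]; first by rewrite -leqNgt andbC.
by rewrite -leqNgt => /andP[le_ik _]; rewrite -exprM mulnAC -expnD subnK.
Qed.

Lemma lower_part_mcoeff0 i : (lower_part i)@_0%MM != 0.
Proof.
rewrite rmorph_prod /=; apply/prodf_neq0 => k _; rewrite rmorphXn expf_neq0 //=.
by rewrite -(central_line0 beta); apply: (separating_root0 separating).
Qed.

Lemma upper_part_nonroot i a : root (central_line beta (h i)) a ->
  ~~ root (central_line beta (upper_part i)) a.
Proof.
move=> ra; rewrite rmorph_prod rootE horner_prod; apply/prodf_neq0 => k /andP[neq_ki _].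
rewrite rmorphXn horner_exp expf_neq0 //.
exact: (separating_disjoint separating neq_ki ra).
Qed.

Variables (kappa : nat) (computable : {mpoly K[n]} -> nat -> Prop).
Hypothesis cost : cost_measure kappa computable.

Local Notation base := (kappa * D.+3)%N.

Let base_gt0 : (0 < base)%N.
Proof. by rewrite muln_gt0 (overhead_gt0 cost). Qed.

Lemma level_lower_part S i : (0 < S)%N ->
  (forall k, (e k < e i)%N -> computable (h k ^+ (p ^ e k)) S) ->
  level kappa computable D S 2 (lower_part i).
Proof.
move=> S_gt0 comp_h; rewrite /lower_part big_mkcond.
apply: (level_prod cost S_gt0) => [|k]; first by rewrite ltnW // ltnW // !ltnS r_leq.
case: ifP => [lt_ki|_]; last by rewrite -mpolyC1; apply: level_const.
rewrite exprM; apply: (level_exp cost S_gt0 (i := 0)) => //.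
  by rewrite ltnW // ltnW // !ltnS j_leq.
by apply/level0P; split; [apply: comp_h | apply/leqW/msize_power].
Qed.

(* 2 levels for the product of the powers already found, 24 for the quotient by it,
   and 34 t + 24 for the extraction. *)
Definition stage_levels : nat := 34 * t + 50.

Lemma computable_next_power S i : (0 < S)%N -> computable f S ->
  (forall k, (e k < e i)%N -> computable (h k ^+ (p ^ e k)) S) ->
  computable (h i ^+ (p ^ e i)) (base ^ stage_levels * S)%N.
Proof.
move=> S_gt0 comp_f comp_lower.
have S2_gt0 : (0 < base ^ 2 * S)%N by rewrite muln_gt0 expn_gt0 base_gt0.
have def_AB := lower_upper_split i; set A := lower_part i in def_AB.
set B := u%:MP * _ in def_AB.
have [nzA nzB] : A != 0 /\ B != 0 by apply/norP; rewrite -mulf_eq0 -def_AB.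
have szA : (msize A <= D.+1)%N by apply: leq_trans szf; apply: msize_dvd_leq def_AB nzf.
have szB : (msize B <= D.+1)%N.
  by apply: leq_trans szf; apply: (msize_dvd_leq (h := A)); rewrite // mulrC.
have [comp_B _] : level kappa computable D (base ^ 2 * S) 24 B.
  apply: (level_quotient cost _ def_AB nzf szf) => //; first exact: lower_part_mcoeff0.
    apply/level0P; split; last exact: leqW.
    by apply: (computable_leq cost _ comp_f); rewrite leq_pmull // expn_gt0 base_gt0.
  by apply/level0P; split; [have [] := level_lower_part S_gt0 comp_lower | apply: leqW].
have size_gt0 : (0 < base ^ 24 * (base ^ 2 * S))%N by rewrite muln_gt0 expn_gt0 base_gt0.
have comp_h := computable_inseparable_factor charK cost size_gt0 lt_D (erefl B) nzB szB
  (ndvd i) (separating_size separating i) (separating_deriv separating (k := i))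
  (@upper_part_nonroot i) comp_B.
apply: (computable_leq cost _ comp_h).
by rewrite (mulnA _ _ S) -expnD (mulnA _ _ S) -expnD /stage_levels -addnA.
Qed.

Lemma computable_power s i : (0 < s)%N -> computable f s ->
  computable (h i ^+ (p ^ e i)) (base ^ (stage_levels * num_values e) * s)%N.
Proof.
move=> s_gt0 comp_f.
have leq_base k l :
    (k <= l)%N -> (base ^ (stage_levels * k) * s <= base ^ (stage_levels * l) * s)%N.
  by move=> le_kl; rewrite leq_mul2r leq_pexp2l ?orbT // leq_mul2l le_kl orbT.
have size_gt0 k : (0 < base ^ k * s)%N by rewrite muln_gt0 expn_gt0 base_gt0.
suff comp_h : computable (h i ^+ (p ^ e i))
    (base ^ (stage_levels * (values_below e (e i)).+1) * s)%N.
  by apply: (computable_leq cost _ comp_h); apply/leq_base/values_below_num.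
have [m] := ubnP (e i); elim: m i => // m IH i le_m.
rewrite (mulnS stage_levels) expnD -mulnA; apply: computable_next_power => // [|k lt_ki].
  apply: (computable_leq cost _ comp_f).
  by rewrite leq_pmull // expn_gt0 base_gt0.
apply: (computable_leq cost _ (IH k (leq_trans lt_ki _))) => //.
exact/leq_base/values_below_mono.
Qed.

End IncreasingExponents.

(** * Formulas *)

Lemma formula_nested_ind (R : Type) n (P : formula R n -> Prop) :
  (forall i, P (FVar R i)) -> (forall c, P (FConst n c)) ->
  (forall ts, foldr and True (map P ts) -> P (FAdd ts)) ->
  (forall ts, foldr and True (map P ts) -> P (FMul ts)) -> forall t, P t.
Proof.
move=> Pvar Pconst Padd Pmul; fix IH 1 => -[i|c|ts|ts].
- exact: Pvar.
- exact: Pconst.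
- by apply: Padd; elim: ts => //= t ts IHts; split.
- by apply: Pmul; elim: ts => //= t ts IHts; split.
Qed.

Section FormulaSubst.
Variables (R S : comNzRingType) (n : nat) (phi : {rmorphism R -> S}).
Variables (h : 'I_n -> formula S n) (d : nat).
Hypothesis size_h : forall i, (formula_size (h i) <= d)%N.

Fixpoint formula_subst (t : formula R n) : formula S n :=
  match t with
  | FVar i => h i
  | FConst c => FConst n (phi c)
  | FAdd ts => FAdd (map formula_subst ts)
  | FMul ts => FMul (map formula_subst ts)
  end.

Lemma formula_eval_subst t :
  formula_eval (formula_subst t) =
  mmap (@mpolyC n S \o phi) (fun i => formula_eval (h i)) (formula_eval t).
Proof.
elim/formula_nested_ind: t => [i|c|ts|ts] /=.
- by rewrite mmapXU.
- by rewrite mmapC.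
- by elim: ts => [|t ts IH] /= => [_|[-> /IH ->]]; rewrite ?rmorph0 ?rmorphD.
- by elim: ts => [|t ts IH] /= => [_|[-> /IH ->]]; rewrite ?rmorph1 ?rmorphM.
Qed.

Lemma formula_size_subst t : (formula_size (formula_subst t) <= d.+1 * formula_size t)%N.
Proof.
have gate_leq (x y z : nat) : (x <= d.+1 * z -> 1 + y + x <= d.+1 * (1 + y + z))%N by nia.
elim/formula_nested_ind: t => [i|c|ts|ts] /= => [||le_ts|le_ts].
- by rewrite muln1; apply: leqW.
- by rewrite muln1.
all: rewrite size_map; apply: gate_leq; elim: ts le_ts => [|t ts IH] //= [le_t /IH le_ts].
all: by rewrite mulnDr leq_add.
Qed.

End FormulaSubst.

Lemma formula_computable_map (F K : fieldType) n (iota : {rmorphism F -> K})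
    (f : {mpoly F[n]}) s :
  formula_computable f s -> formula_computable (map_mpoly iota f) (2 * s).
Proof.
move=> [t [<- size_t]]; exists (formula_subst iota (fun i => FVar K i) t); split.
  by rewrite formula_eval_subst.
apply: leq_trans (formula_size_subst iota (d := 1) _ t) _ => //.
by rewrite leq_mul2l size_t.
Qed.

Section FormulaCost.
Variables (K : fieldType) (n : nat).

Definition formula_affine (v w : 'I_n -> K) (i : 'I_n) : formula K n :=
  FAdd [:: FConst n (v i); FMul [:: FConst n (w i); FVar K i]].

Lemma formula_eval_enum N (ts : 'I_N -> formula K n) :
  formula_eval (FAdd [seq ts i | i <- enum 'I_N]) = \sum_i formula_eval (ts i) /\
  formula_eval (FMul [seq ts i | i <- enum 'I_N]) = \prod_i formula_eval (ts i).
Proof. by split; rewrite /= foldrE 2!big_map big_enum. Qed.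

Lemma formula_size_enum N (ts : 'I_N -> formula K n) s :
  (0 < s)%N -> (forall i, formula_size (ts i) <= s)%N ->
  (1 + size [seq ts i | i <- enum 'I_N] +
   sumn [seq formula_size t | t <- [seq ts i | i <- enum 'I_N]] <= 16 * N.+1 * s)%N.
Proof.
move=> s_gt0 size_ts; rewrite size_map size_enum_ord sumnE 2!big_map big_enum /=.
have : (\sum_i formula_size (ts i) <= N * s)%N.
  rewrite -[N in leqRHS]card_ord -sum_nat_const; apply: leq_sum => i _.
  exact: size_ts.
by move: (\sum_i _)%N => x; nia.
Qed.

Lemma formula_cost : cost_measure 16 (@formula_computable K n).
Proof.
split=> [//|f s t le_st [x [def_f size_x]]|c|N f s s_gt0 comp_f|N f s s_gt0 comp_f|].
- by exists x; split=> //; apply: leq_trans le_st.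
- by exists (FConst n c).
- have [ts ts_f] := fin_all_exists comp_f.
  exists (FAdd [seq ts i | i <- enum 'I_N]); split.
    by rewrite (proj1 (formula_eval_enum ts)); apply: eq_bigr => i _; case: (ts_f i).
  by apply: formula_size_enum => // i; case: (ts_f i).
- have [ts ts_f] := fin_all_exists comp_f.
  exists (FMul [seq ts i | i <- enum 'I_N]); split.
    by rewrite (proj2 (formula_eval_enum ts)); apply: eq_bigr => i _; case: (ts_f i).
  by apply: formula_size_enum => // i; case: (ts_f i).
move=> v w _ s s_gt0 [t [<- size_t]].
exists (formula_subst idfun (formula_affine v w) t); split.
  by rewrite formula_eval_subst; apply: eq_mmap => // i; rewrite /= addr0 mulr1.
apply: leq_trans (formula_size_subst idfun (d := 9) _ t) _ => //.
exact: leq_mul.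
Qed.

End FormulaCost.

(** * Algebraic branching programs *)

Section AbpWeight.
Variables (R : comNzRingType) (n : nat).
Implicit Type B : abp R n.

Fixpoint abp_weight B k (u : abp_vertex B) : {mpoly R[n]} :=
  if k is l.+1 then \sum_(v | abp_edge u v) abp_label u v * abp_weight l v
  else (u == abp_sink B)%:R.

Lemma abp_weightE B k (u : abp_vertex B) :
  \sum_(q : k.-tuple (abp_vertex B) | path (@abp_edge _ _ B) u q
          && (last u q == abp_sink B))
    \prod_(a <- pairmap (@abp_label _ _ B) u q) a = abp_weight k u.
Proof.
elim: k u => [|k IH] u.
  rewrite /=; case eq_u: (u == abp_sink B).
    rewrite (big_pred1 [tuple]) => [|q]; first by rewrite big_nil.
    by rewrite [q]tuple0 /= eq_u !eqxx.
  by rewrite big_pred0 // => q; rewrite [q]tuple0 /= eq_u.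
rewrite /= (reindex (fun x : abp_vertex B * k.-tuple (abp_vertex B) =>
   cons_tuple x.1 x.2)) /=; last first.
  exists (fun q : k.+1.-tuple (abp_vertex B) => (thead q, behead_tuple q)).
    by move=> [v q] _ /=; congr pair; apply: val_inj.
  by move=> q _; rewrite [RHS]tuple_eta; apply: val_inj.
transitivity (\sum_(v | abp_edge u v) \sum_(q : k.-tuple (abp_vertex B) |
    path (@abp_edge _ _ B) v q && (last v q == abp_sink B))
    \prod_(a <- pairmap (@abp_label _ _ B) u (v :: q)) a).
  by rewrite pair_big_dep /=; apply: eq_bigl => -[v q] /=; rewrite andbA.
apply: eq_bigr => v _; rewrite -IH big_distrr /=; apply: eq_bigr => q _.
by rewrite big_cons.
Qed.

Lemma abp_evalE B : abp_eval B = abp_weight (abp_depth B) (abp_source B).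
Proof. exact: abp_weightE. Qed.

Lemma abp_layer_source B : abp_layer (abp_source B) = 0%N.
Proof. exact/abp_sourceP. Qed.

Lemma abp_layer_sink B : abp_layer (abp_sink B) = abp_depth B.
Proof. exact/abp_sinkP. Qed.

Lemma abp_edge_to_source B u : abp_edge u (abp_source B) = false.
Proof. by apply/negP => /(@abp_edge_layer _ _ B); rewrite abp_layer_source. Qed.

Lemma abp_edge_from_sink B v : abp_edge (abp_sink B) v = false.
Proof.
apply/negP => /(@abp_edge_layer _ _ B) layer_v; have := abp_layer_le v.
by rewrite layer_v abp_layer_sink ltnn.
Qed.

Lemma abp_weight_neq0_leq B k (u : abp_vertex B) : abp_weight k u != 0 ->
  (k <= #|[set x : abp_vertex B * abp_vertex B |
           abp_edge x.1 x.2 && (abp_layer u <= abp_layer x.1)%N]|)%N.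
Proof.
elim: k u => [|k IH] u //= nzw.
have [v uv nzv] : exists2 v, abp_edge u v & abp_weight k v != 0.
  apply/exists_inP; apply: contraNT nzw => /exists_inPn no_v.
  by rewrite big1 // => v /no_v; rewrite negbK => /eqP->; rewrite mulr0.
apply: leq_ltn_trans (IH v nzv) _; apply/proper_card/properP; split.
  apply/subsetP => x; rewrite !inE (abp_edge_layer uv) => /andP[->].
  exact: ltnW.
by exists (u, v); rewrite !inE /= uv ?leqnn // (abp_edge_layer uv) ltnn.
Qed.

Lemma abp_depth_leq B : abp_eval B != 0 -> (abp_depth B <= abp_size B)%N.
Proof.
rewrite abp_evalE => /abp_weight_neq0_leq le_depth; apply: leq_trans le_depth _.
by apply/subset_leq_card/subsetP => x; rewrite !inE => /andP[].
Qed.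

End AbpWeight.

Section AbpSize.
Variables (R : comNzRingType) (n : nat).
Implicit Types A B C : abp R n.

Lemma abp_size_leq B (l : seq (abp_vertex B * abp_vertex B)) :
  (forall u v, abp_edge u v -> (u, v) \in l) -> (abp_size B <= size l)%N.
Proof.
move=> sub_l; apply: leq_trans (card_size l).
by apply/subset_leq_card/subsetP => -[u v]; rewrite inE => /sub_l.
Qed.

Lemma abp_size_glue A B C (inA : abp_vertex A -> abp_vertex C)
    (inB : abp_vertex B -> abp_vertex C) (extra : seq (abp_vertex C * abp_vertex C)) :
  (forall u v, abp_edge u v ->
    [\/ exists2 x, abp_edge x.1 x.2 & (u, v) = (inA x.1, inA x.2),
        exists2 x, abp_edge x.1 x.2 & (u, v) = (inB x.1, inB x.2) |
        (u, v) \in extra]) ->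
  (abp_size C <= abp_size A + abp_size B + size extra)%N.
Proof.
move=> edgeC.
pose edges (D : abp R n) := enum [set x : abp_vertex D * abp_vertex D | abp_edge x.1 x.2].
have size_edges D : size (edges D) = abp_size D by rewrite /edges -cardE.
pose l := [seq (inA x.1, inA x.2) | x <- edges A] ++
          [seq (inB x.1, inB x.2) | x <- edges B] ++ extra.
have -> : (abp_size A + abp_size B + size extra = size l)%N.
  by rewrite !size_cat !size_map !size_edges addnA.
apply: abp_size_leq => u v /edgeC; rewrite !mem_cat.
case=> [[x xA ->]|[x xB ->]|->]; last by rewrite !orbT.
  by rewrite map_f // mem_enum inE.
by rewrite map_f ?orbT // mem_enum inE.
Qed.

End AbpSize.

Section AbpConstructions.
Variables (R : comNzRingType) (n : nat).
Implicit Type A B : abp R n.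

Lemma abp_one : exists B : abp R n,
  [/\ abp_depth B = 0%N, abp_eval B = 1 & abp_size B = 0%N].
Proof.
pose label (u v : unit) : {mpoly R[n]} := 0.
have layer_le (v : unit) : (0 <= 0)%N by [].
have layerP (v : unit) : 0%N = 0%N <-> v = tt by case: v.
have edge_layer (u v : unit) : false -> 0%N = 1%N by [].
have label_affine (u v : unit) : false -> (msize (label u v) <= 2)%N by [].
exists (@Abp R n unit 0 (fun=> 0%N) tt tt (fun _ _ => false) label
  layer_le layerP layerP edge_layer label_affine).
by split; rewrite ?abp_evalE //; apply: eq_card0 => x; rewrite inE.
Qed.

Lemma abp_affine (l : {mpoly R[n]}) : (msize l <= 2)%N ->
  exists B : abp R n, [/\ abp_depth B = 1%N, abp_eval B = l & (abp_size B <= 1)%N].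
Proof.
move=> szl; pose edge (u v : bool) := ~~ u && v; pose label (u v : bool) := l.
have layer_le (v : bool) : (v <= 1)%N by case: v.
have sourceP (v : bool) : v = 0%N :> nat <-> v = false by case: v.
have sinkP (v : bool) : v = 1%N :> nat <-> v = true by case: v.
have edge_layer u v : edge u v -> v = u.+1 :> nat by case: u v => [] [].
have label_affine u v : edge u v -> (msize (label u v) <= 2)%N by [].
pose B := @Abp R n bool 1 nat_of_bool false true edge label
  layer_le sourceP sinkP edge_layer label_affine.
exists B; split=> //; first by rewrite abp_evalE /= (big_pred1 true) /= ?mulr1 // => -[].
by apply: (@abp_size_leq _ _ B [:: (false, true)]) => -[] [].
Qed.

Section Series.
Variables A B : abp R n.

Definition series_layer (x : abp_vertex A + abp_vertex B) : nat :=
  match x with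
  | inl u => abp_layer u
  | inr v => (abp_layer v + (abp_depth A).+1)%N
  end.

Definition series_edge (x y : abp_vertex A + abp_vertex B) : bool :=
  match x, y with
  | inl u, inl v => abp_edge u v
  | inr u, inr v => abp_edge u v
  | inl u, inr v => (u == abp_sink A) && (v == abp_source B)
  | inr _, inl _ => false
  end.

Definition glue_label (x y : abp_vertex A + abp_vertex B) : {mpoly R[n]} :=
  match x, y with
  | inl u, inl v => abp_label u v
  | inr u, inr v => abp_label u v
  | _, _ => 1
  end.

Lemma series_layer_le x : (series_layer x <= abp_depth B + (abp_depth A).+1)%N.
Proof. by case: x => v /=; have := abp_layer_le v; lia. Qed.

Lemma series_sourceP x : series_layer x = 0%N <-> x = inl (abp_source A).
Proof.
case: x => v /=; last by split=> //; lia.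
by rewrite abp_sourceP; split=> [->|[->]].
Qed.

Lemma series_sinkP x :
  series_layer x = (abp_depth B + (abp_depth A).+1)%N <-> x = inr (abp_sink B).
Proof.
case: x => v /=; first by split=> //; have := abp_layer_le v; lia.
by split=> [/addIn/abp_sinkP->//|[->]]; rewrite abp_layer_sink.
Qed.

Lemma series_edge_layer x y : series_edge x y -> series_layer y = (series_layer x).+1.
Proof.
case: x y => u [] v //= => [/(@abp_edge_layer _ _ A)//| |].
  by case/andP => /eqP-> /eqP->; rewrite abp_layer_source abp_layer_sink.
by move/(@abp_edge_layer _ _ B)->.
Qed.

Lemma series_label_affine x y : series_edge x y -> (msize (glue_label x y) <= 2)%N.
Proof. by case: x y => u [] v //=; rewrite ?msize1 //; apply: abp_label_affine. Qed.

Definition abp_series : abp R n :=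
  @Abp R n (abp_vertex A + abp_vertex B)%type (abp_depth B + (abp_depth A).+1)
    series_layer (inl (abp_source A)) (inr (abp_sink B)) series_edge glue_label
    series_layer_le series_sourceP series_sinkP series_edge_layer series_label_affine.

Lemma series_weight_inr k v : abp_weight (B := abp_series) k (inr v) = abp_weight k v.
Proof.
elim: k v => [|k IH] v //=.
by rewrite big_sumType /= big_pred0 // add0r; apply: eq_bigr => w _; rewrite IH.
Qed.

Lemma series_weight_inl k u : (abp_layer u + k = abp_depth A)%N ->
  abp_weight (B := abp_series) (abp_depth B + k.+1) (inl u) = abp_weight k u * abp_eval B.
Proof.
elim: k u => [|k IH] u.
  rewrite addn0 => /abp_sinkP-> /=; rewrite eqxx mul1r addn1 /= big_sumType /=.
  rewrite big_pred0 => [|v]; last exact: abp_edge_from_sink.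
  rewrite add0r (big_pred1 (abp_source B)) => [|v]; last by rewrite eqxx.
  by rewrite mul1r series_weight_inr abp_evalE.
move=> layer_u; rewrite addnS /= big_sumType /= [X in _ + X]big_pred0 => [|v]; last first.
  by apply: contra_eqF layer_u => /andP[/eqP-> _]; rewrite abp_layer_sink; lia.
rewrite addr0 big_distrl /=; apply: eq_bigr => v uv.
by rewrite IH ?mulrA // (abp_edge_layer uv); lia.
Qed.

Lemma abp_eval_series : abp_eval abp_series = abp_eval A * abp_eval B.
Proof. by rewrite abp_evalE series_weight_inl ?abp_evalE // abp_layer_source. Qed.

Lemma abp_size_series : (abp_size abp_series <= abp_size A + abp_size B + 1)%N.
Proof.
apply: (@abp_size_glue _ _ A B abp_series inl inr [:: (inl (abp_sink A), inr (abp_source B))]).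
case=> [u|u] [v|v] //= uv; [apply: Or31 | apply: Or33 | apply: Or32].
- by exists (u, v).
- by case/andP: uv => /eqP-> /eqP->; rewrite mem_head.
- by exists (u, v).
Qed.

End Series.

(* Attaching B inside the deeper program A keeps the depth of A, so that long
   sums need no repeated padding. *)
Section Parallel.
Variables A B : abp R n.
Hypothesis depthAB : abp_depth A = (abp_depth B).+2.

Definition parallel_layer (x : abp_vertex A + abp_vertex B) : nat :=
  match x with
  | inl u => abp_layer u
  | inr v => (abp_layer v).+1
  end.

Definition parallel_edge (x y : abp_vertex A + abp_vertex B) : bool :=
  match x, y with
  | inl u, inl v => abp_edge u v
  | inr u, inr v => abp_edge u v
  | inl u, inr v => (u == abp_source A) && (v == abp_source B)
  | inr u, inl v => (u == abp_sink B) && (v == abp_sink A)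
  end.

Lemma parallel_layer_le x : (parallel_layer x <= abp_depth A)%N.
Proof. by case: x => v /=; have := abp_layer_le v; lia. Qed.

Lemma parallel_sourceP x : parallel_layer x = 0%N <-> x = inl (abp_source A).
Proof. by case: x => v //=; rewrite abp_sourceP; split=> [->|[->]]. Qed.

Lemma parallel_sinkP x : parallel_layer x = abp_depth A <-> x = inl (abp_sink A).
Proof.
case: x => v /=; last by split=> //; have := abp_layer_le v; lia.
by rewrite abp_sinkP; split=> [->|[->]].
Qed.

Lemma parallel_edge_layer x y :
  parallel_edge x y -> parallel_layer y = (parallel_layer x).+1.
Proof.
case: x y => u [] v //= => [/(@abp_edge_layer _ _ A)//| | |].
- by case/andP => /eqP-> /eqP->; rewrite !abp_layer_source.
- by case/andP => /eqP-> /eqP->; rewrite !abp_layer_sink.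
- by move/(@abp_edge_layer _ _ B)->.
Qed.

Lemma parallel_label_affine x y :
  parallel_edge x y -> (msize (glue_label x y) <= 2)%N.
Proof. by case: x y => u [] v //=; rewrite ?msize1 //; apply: abp_label_affine. Qed.

Definition abp_parallel : abp R n :=
  @Abp R n (abp_vertex A + abp_vertex B)%type (abp_depth A) parallel_layer
    (inl (abp_source A)) (inl (abp_sink A)) parallel_edge (@glue_label A B)
    parallel_layer_le parallel_sourceP parallel_sinkP parallel_edge_layer
    parallel_label_affine.

Lemma parallel_weight_sink k :
  abp_weight (B := abp_parallel) k.+1 (inl (abp_sink A)) = 0.
Proof.
have neq_sink : abp_sink A != abp_source A.
  by apply/eqP => eq_s; have := abp_layer_sink A; rewrite eq_s abp_layer_source depthAB.
rewrite /= big_sumType /= !big_pred0 ?addr0 // => v; first by rewrite (negPf neq_sink).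
exact: abp_edge_from_sink.
Qed.

Lemma parallel_weight_inr k v :
  abp_weight (B := abp_parallel) k.+1 (inr v) = abp_weight k v.
Proof.
elim: k v => [|k IH] v.
  rewrite /= big_sumType /= [X in _ + X]big1 => [|w _]; last by rewrite mulr0.
  rewrite addr0; case: eqP => [_|_] /=; last by rewrite big_pred0.
  by rewrite (big_pred1 (abp_sink A)) //= eqxx mulr1.
rewrite [LHS]/= big_sumType /= big1 => [|w /andP[_ /eqP->]]; last first.
  by rewrite mul1r; apply: parallel_weight_sink.
by rewrite add0r; apply: eq_bigr => w _; congr (_ * _); apply: IH.
Qed.

Lemma parallel_weight_inl k u : u != abp_source A ->
  abp_weight (B := abp_parallel) k (inl u) = abp_weight k u.
Proof.
elim: k u => [|k IH] u neq_u //=.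
rewrite big_sumType /= [X in _ + X]big_pred0 => [|v]; last by rewrite (negPf neq_u).
rewrite addr0; apply: eq_bigr => v uv; rewrite IH //.
by apply: contraTneq uv => ->; rewrite abp_edge_to_source.
Qed.

Lemma abp_eval_parallel : abp_eval abp_parallel = abp_eval A + abp_eval B.
Proof.
rewrite !abp_evalE /= depthAB /= big_sumType /=; congr (_ + _).
  apply: eq_bigr => v uv; congr (_ * _); apply: (@parallel_weight_inl (abp_depth B).+1).
  by apply: contraTneq uv => ->; rewrite abp_edge_to_source.
rewrite (big_pred1 (abp_source B)) => [|v]; last by rewrite eqxx.
by rewrite mul1r; apply: parallel_weight_inr.
Qed.

Lemma abp_size_parallel : (abp_size abp_parallel <= abp_size A + abp_size B + 2)%N.
Proof.
apply: (@abp_size_glue _ _ A B abp_parallel inl inr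
  [:: (inl (abp_source A), inr (abp_source B)); (inr (abp_sink B), inl (abp_sink A))]).
case=> [u|u] [v|v] /= uv; [apply: Or31 | apply: Or33 | apply: Or33 | apply: Or32].
- by exists (u, v).
- by case/andP: uv => /eqP-> /eqP->; rewrite mem_head.
- by case/andP: uv => /eqP-> /eqP->; rewrite in_cons mem_head orbT.
- by exists (u, v).
Qed.

End Parallel.

Lemma abp_pad B d : (abp_depth B <= d)%N -> exists C : abp R n, [/\
  abp_depth C = d, abp_eval C = abp_eval B &
  (abp_size C <= abp_size B + (d - abp_depth B))%N].
Proof.
move=> /subnK; move: (d - abp_depth B)%N => k <-; elim: k => [|k [C [dC eC sC]]].
  by exists B; rewrite addn0.
have [E [dE eE sE]] := abp_one; exists (abp_series C E); split.
- by rewrite /= dE dC.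
- by rewrite abp_eval_series eE mulr1.
- by have := abp_size_series C E; rewrite sE; move: sC; lia.
Qed.

Lemma abp_prod N (f : 'I_N -> {mpoly R[n]}) s : (forall i, abp_computable (f i) s) ->
  abp_computable (\prod_i f i) (N * s.+1).
Proof.
elim: N f => [|N IH] f comp_f.
  by have [B [_ eB sB]] := abp_one; exists B; rewrite big_ord0 sB.
have [A [eA sA]] := IH _ (fun i => comp_f (widen_ord (leqnSn N) i)).
have [B [eB sB]] := comp_f ord_max; exists (abp_series A B).
rewrite abp_eval_series eA eB big_ord_recr; split=> //.
by have := abp_size_series A B; move: sA sB; nia.
Qed.

Lemma abp_normalize (f : {mpoly R[n]}) s : (0 < s)%N -> abp_computable f s ->
  exists B : abp R n, [/\ abp_depth B = s, abp_eval B = f & (abp_size B <= 2 * s)%N].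
Proof.
move=> s_gt0 [B [def_f size_B]]; have [f0|nzf] := eqVneq f 0.
  have [|Z [dZ eZ sZ]] := abp_affine (l := 0); first by rewrite msize0.
  have [|C [dC eC sC]] := @abp_pad Z s; first by rewrite dZ.
  by exists C; rewrite eC eZ f0; split=> //; move: sC sZ; lia.
have depth_B : (abp_depth B <= s)%N.
  by apply: leq_trans size_B; apply: abp_depth_leq; rewrite def_f.
have [C [dC eC sC]] := abp_pad depth_B; exists C; rewrite eC; split=> //.
by move: sC size_B; lia.
Qed.

Lemma abp_sum N (f : 'I_N -> {mpoly R[n]}) s : (0 < s)%N ->
  (forall i, abp_computable (f i) s) ->
  abp_computable (\sum_i f i) (s.+2 + N * (2 * s + 2)).
Proof.
move=> s_gt0 comp_f.
suff [C [_ eC sC]] : exists C : abp R n, [/\ abp_depth C = s.+2, abp_eval C = \sum_i f i &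
    (abp_size C <= s.+2 + N * (2 * s + 2))%N] by exists C.
elim: N f comp_f => [|N IH] f comp_f.
  have [|Z [dZ eZ sZ]] := abp_affine (l := 0); first by rewrite msize0.
  have [|C [dC eC sC]] := @abp_pad Z s.+2; first by rewrite dZ.
  by exists C; rewrite eC eZ big_ord0; split=> //; move: sC sZ; rewrite dZ; lia.
have [A [dA eA sA]] := IH _ (fun i => comp_f (widen_ord (leqnSn N) i)).
have [B [dB eB sB]] := abp_normalize s_gt0 (comp_f ord_max).
have depthAB : abp_depth A = (abp_depth B).+2 by rewrite dA dB.
exists (abp_parallel depthAB); rewrite abp_eval_parallel eA eB big_ord_recr; split=> //.
by have := abp_size_parallel depthAB; move: sA sB; nia.
Qed.

End AbpConstructions.

Lemma abp_computable_rmorph (R S : comNzRingType) n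
    (phi : {rmorphism {mpoly R[n]} -> {mpoly S[n]}}) (f : {mpoly R[n]}) s :
  (forall l, msize l <= 2 -> msize (phi l) <= 2)%N ->
  abp_computable f s -> abp_computable (phi f) s.
Proof.
move=> phi_affine [B [<- size_B]].
have label_affine u v : @abp_edge _ _ B u v -> (msize (phi (abp_label u v)) <= 2)%N.
  by move=> uv; apply/phi_affine/abp_label_affine.
pose C := @Abp S n (abp_vertex B) _ (@abp_layer _ _ B) (abp_source B) (abp_sink B)
  (@abp_edge _ _ B) (fun u v => phi (abp_label u v)) (@abp_layer_le _ _ B)
  (@abp_sourceP _ _ B) (@abp_sinkP _ _ B) (@abp_edge_layer _ _ B) label_affine.
have weightC k u : abp_weight (B := C) k u = phi (abp_weight (B := B) k u).
  elim: k u => [|k IH] u /=; first by rewrite rmorph_nat.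
  by rewrite rmorph_sum; apply: eq_bigr => v _; rewrite rmorphM IH.
by exists C; rewrite !abp_evalE; split=> //; apply: weightC.
Qed.

Lemma abp_computable_map (F K : fieldType) n (iota : {rmorphism F -> K})
    (f : {mpoly F[n]}) s :
  abp_computable f s -> abp_computable (map_mpoly iota f) s.
Proof.
apply: (abp_computable_rmorph (phi := map_mpoly iota)) => l.
by rewrite msize_map_mpoly //; apply: fmorph_inj.
Qed.

Lemma abp_cost (K : fieldType) n : cost_measure 16 (@abp_computable K n).
Proof.
have leq f s t : (s <= t)%N -> abp_computable f s -> @abp_computable K n f t.
  by move=> le_st [B [eB sB]]; exists B; split=> //; apply: leq_trans le_st.
split=> [//||c|N f s s_gt0 comp_f|N f s s_gt0 comp_f|v w f s s_gt0 comp_f] //.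
- have [|B [_ eB sB]] := abp_affine (l := c%:MP_[n]); last by exists B.
  by rewrite msizeC (leq_trans (leq_b1 _)).
- by apply: leq (abp_sum s_gt0 comp_f); nia.
- by apply: leq (abp_prod comp_f); nia.
apply: leq (_ : s <= 16 * s)%N _; first exact: leq_pmull.
apply: (abp_computable_rmorph (phi := affine_subst v w)) comp_f => l.
exact/leq_trans/msize_affine_subst.
Qed.

(** * Cost of the irreducible powers *)

Section Shift.
Variables (R : idomainType) (n : nat).
Implicit Types (a : 'I_n -> R) (f : {mpoly R[n]}).

Definition shift a : {mpoly R[n]} -> {mpoly R[n]} := affine_subst a (fun=> 1).

HB.instance Definition _ a := GRing.RMorphism.on (shift a).

Lemma shiftX a j : shift a 'X_j = (a j)%:MP + 'X_j.
Proof. by rewrite /shift affine_substX mpolyC1 mul1r. Qed.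

Lemma shiftK a : cancel (shift a) (shift (fun j => - a j)).
Proof.
apply: (@mpoly_rmorph_ext _ _ _ (shift (fun j => - a j) \o shift a) idfun) => [c|j] /=.
  by rewrite /shift !affine_substC.
by rewrite shiftX rmorphD /= shiftX /shift affine_substC addrA -mpolyCD subrr mpolyC0 add0r.
Qed.

Lemma msize_shift a f : msize (shift a f) = msize f.
Proof.
apply/eqP; rewrite eqn_leq msize_affine_subst -{1}[f](shiftK a).
exact: msize_affine_subst.
Qed.

End Shift.

Lemma central_line_shift (F K : fieldType) (iota : {rmorphism F -> K}) n (a b : 'I_n -> K)
    (f : {mpoly F[n]}) :
  line idfun (fun=> 0) b (shift a (map_mpoly iota f)) = line iota a b f.
Proof.
apply: (@mpoly_rmorph_ext _ _ _
  (line idfun (fun=> 0) b \o shift a \o map_mpoly iota) (line iota a b)) => [c|j] /=.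
  by rewrite map_mpolyC /shift affine_substC !lineC.
by rewrite map_mpolyX shiftX rmorphD /= lineC !lineX polyC0 add0r.
Qed.

Lemma separating_line_shift (F K : fieldType) (iota : {rmorphism F -> K}) n r
    (a b : 'I_n -> K) (fs : 'I_r -> {mpoly F[n]}) :
  separating_line iota a b fs ->
  separating_line idfun (fun=> 0) b (fun k => shift a (map_mpoly iota (fs k))).
Proof.
case=> size_fs root0 deriv_fs disjoint.
split=> [k|k|k z|i k z]; rewrite ?central_line_shift //.
- by rewrite size_fs msize_shift msize_map_mpoly //; apply: fmorph_inj.
- exact: deriv_fs.
- exact: disjoint.
Qed.

Section IrreduciblePower.
Variables (p : nat) (F : fieldType) (n r : nat) (f : {mpoly F[n]}).
Variables (fs : 'I_r -> {mpoly F[n]}) (e j : 'I_r -> nat).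
Hypothesis charF : p \in [pchar F].
Hypothesis factorization : irreducible_factorization p f fs e j.

Lemma num_values_leq : (num_values e <= (msize f).-1)%N.
Proof.
have [irr _ ndvd [u nzu def_f]] := factorization.
have nzf : f != 0.
  rewrite def_f mulf_neq0 ?mpolyC_eq0 //; apply/prodf_neq0 => k _.
  by rewrite expf_neq0 //; case: (irr k).
have lt_r : (r < msize f)%N.
  apply: num_factors_ltn def_f nzf (fun k => irreducible_msize (irr k)) _ => k.
  rewrite muln_gt0 expn_gt0 prime_gt0 ?(pcharf_prime charF) //=.
  by case: (j k) (ndvd k) => //; rewrite dvdn0.
apply: leq_trans (size_undup _) _; rewrite size_codom card_ord.
by rewrite -ltnS (ltn_predK lt_r).
Qed.

Variables (K : closedFieldType) (phi : {rmorphism 'F_p -> K}) (iota : {rmorphism F -> K}).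
Hypothesis closureK : prime_field_closure phi.
Variables (kappa : nat) (computable : {mpoly K[n]} -> nat -> Prop).
Hypothesis cost : cost_measure kappa computable.

Lemma computable_irreducible_power (D s t : nat) (i : 'I_r) :
  ((msize f).-1 <= D)%N -> (0 < s)%N -> (D < 2 ^ t)%N ->
  computable (map_mpoly iota f) s ->
  computable (map_mpoly iota (fs i ^+ (p ^ e i)))
    (kappa * ((kappa * D.+3) ^ (stage_levels t * num_values e) * (kappa * s)))%N.
Proof.
move=> szf s_gt0 lt_D comp_f; have [irr fs_inj ndvd [u nzu def_f]] := factorization.
have separable_fs k : exists l, (fs k)^`M(l) != 0.
  apply: irreducible_mderiv charF _ (irr k) => x.
  exact: algebraic_pth_power iota x charF closureK.
have [a [b separating]] := separating_line_exists irr fs_inj separable_fs iota.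
have kappa_gt0 := overhead_gt0 cost.
pose h k := shift a (map_mpoly iota (fs k)).
have szh k : (1 < msize (h k))%N.
  by rewrite msize_shift msize_map_mpoly ?irreducible_msize //; apply: fmorph_inj.
have szg : (msize (shift a (map_mpoly iota f)) <= D.+1)%N.
  rewrite msize_shift msize_map_mpoly; last exact: fmorph_inj.
  by apply: leq_trans (leqSpred _) _; rewrite ltnS.
have def_g : shift a (map_mpoly iota f) = (iota u)%:MP * \prod_k h k ^+ (p ^ e k * j k).
  rewrite def_f !rmorphM /= map_mpolyC /shift affine_substC; congr (_ * _).
  by rewrite !rmorph_prod; apply: eq_bigr => k _; rewrite !rmorphXn.
have comp_g : computable (shift a (map_mpoly iota f)) (kappa * s).
  exact: computable_affine_subst.
have comp_h := computable_power (rmorph_pchar iota charF) lt_D _ szg def_g szh ndvd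
  (separating_line_shift separating) cost i _ comp_g.
rewrite -(shiftK a (map_mpoly iota (fs i ^+ _))).
apply: (computable_affine_subst cost).
  by rewrite !muln_gt0 expn_gt0 muln_gt0 kappa_gt0.
rewrite !rmorphXn /= -/(h i).
by apply: comp_h; rewrite ?fmorph_eq0 ?muln_gt0 ?kappa_gt0.
Qed.

End IrreduciblePower.

(** * Quasipolynomial bounds *)

Definition degree_exponent (a : nat) : nat := 16 * a.+3 + a.

Lemma degree_overhead_leq (a n : nat) :
  (1 < n)%N -> (16 * (a * n ^ a).+3 <= n ^ degree_exponent a)%N.
Proof.
move=> n_gt1; apply: (@leq_trans (16 * a.+3 * n ^ a)).
  have : (0 < n ^ a)%N by rewrite expn_gt0 ltnW.
  by move: (n ^ a)%N => x; nia.
rewrite /degree_exponent expnD leq_mul2r.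
rewrite (leq_trans (ltnW (ltn_expl (16 * a.+3) (ltnSn 1)))) ?orbT //.
exact: leq_wexp2r.
Qed.

Lemma log_degree_leq (a n : nat) :
  (1 < n)%N -> (up_log 2 (a * n ^ a).+1 <= log2n n * degree_exponent a)%N.
Proof.
move=> n_gt1; apply: up_log_min => //.
apply: leq_trans (leq_trans (_ : _ <= 16 * (a * n ^ a).+3)%N (degree_overhead_leq a n_gt1)) _.
  by lia.
by rewrite expnM leq_wexp2r ?up_logP.
Qed.

Definition factor_cost (a b n lam : nat) : nat :=
  16 * ((16 * (a * n ^ a).+3) ^ (stage_levels (up_log 2 (a * n ^ a).+1) * lam)
    * (16 * (2 * (b.+1 * n ^ (b * log2n n))))).

Lemma factor_cost_small (a b n lam : nat) : (n <= 1)%N -> (lam <= a * n ^ a)%N ->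
  (factor_cost a b n lam <=
   16 * ((16 * a.+3) ^ (stage_levels (up_log 2 a.+1) * a) * (16 * (2 * b.+1))))%N.
Proof.
move=> n_le1 le_lam; have leD : (a * n ^ a <= a)%N.
  by rewrite -[leqRHS]muln1 leq_mul // -[leqRHS](exp1n a) leq_wexp2r.
have log0 : log2n n = 0%N by case: n n_le1 {leD le_lam} => [|[]].
rewrite /factor_cost log0 muln0 muln1 leq_mul2l leq_mul2r; apply/orP; right; apply/orP; right.
apply: leq_trans (leq_wexp2r _ (_ : _ <= 16 * a.+3)%N) _; first by rewrite leq_mul2l !ltnS leD.
rewrite leq_pexp2l // leq_mul ?(leq_trans le_lam) //.
by rewrite /stage_levels leq_add2r leq_mul2l leq_up_log.
Qed.

Lemma factor_cost_large (a b n lam : nat) : (1 < n)%N -> (0 < lam)%N ->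
  (factor_cost a b n lam <= 512 * b.+1 *
   (n ^ (lam * log2n n)) ^ (degree_exponent a * stage_levels (degree_exponent a) + b))%N.
Proof.
move=> n_gt1 lam_gt0; set k := degree_exponent a; set l := log2n n; set m := (n ^ (lam * l))%N.
have l_gt0 : (0 < l)%N by rewrite up_log_gt0.
have le_levels : (stage_levels (up_log 2 (a * n ^ a).+1) * lam <= stage_levels k * (lam * l))%N.
  by have := log_degree_leq a n_gt1; rewrite /stage_levels -/k -/l; nia.
have le_power : ((16 * (a * n ^ a).+3) ^ (stage_levels (up_log 2 (a * n ^ a).+1) * lam)
    <= m ^ (k * stage_levels k))%N.
  apply: (@leq_trans ((n ^ k) ^ (stage_levels k * (lam * l)))); last first.
    by rewrite -!expnM leq_pexp2l ?(ltnW n_gt1) //; lia.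
  apply: leq_trans (leq_pexp2l _ le_levels); last by rewrite expn_gt0 ltnW.
  exact/leq_wexp2r/degree_overhead_leq.
have le_b : (n ^ (b * l) <= m ^ b)%N.
  by rewrite -expnM leq_pexp2l ?(ltnW n_gt1) // mulnC leq_mul2r leq_pmull ?orbT.
apply: (@leq_trans (512 * b.+1 * (m ^ (k * stage_levels k) * m ^ b))); last by rewrite expnD.
have regroup (x y z : nat) : (16 * (x * (16 * (2 * (z * y)))) = 512 * z * (x * y))%N by lia.
by rewrite /factor_cost regroup leq_mul2l leq_mul ?orbT.
Qed.

Lemma factor_cost_leq (a b : nat) : exists c, forall n lam,
  (0 < lam)%N -> (lam <= a * n ^ a)%N ->
  (factor_cost a b n lam <= c * (n ^ (lam * log2n n)) ^ c)%N.
Proof.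
pose k := degree_exponent a.
pose small_cost := (16 * ((16 * a.+3) ^ (stage_levels (up_log 2 a.+1) * a) * (16 * (2 * b.+1))))%N.
exists (small_cost + 512 * b.+1 + (k * stage_levels k + b))%N => n lam lam_gt0 le_lam.
set c := (small_cost + _ + _)%N; have [n_le1|n_gt1] := leqP n 1.
  apply: leq_trans (factor_cost_small b n_le1 le_lam) _.
  have -> : log2n n = 0%N by case: n n_le1 {le_lam} => [|[]].
  by rewrite muln0 expn0 exp1n muln1 /c -addnA leq_addr.
apply: leq_trans (factor_cost_large a b n_gt1 lam_gt0) _.
rewrite leq_mul ?leq_pexp2l ?expn_gt0 ?(ltnW n_gt1) // /c; last exact: leq_addl.
by rewrite addnAC leq_addl.
Qed.

Lemma computable_irreducible_power_bound (p : nat) (F : fieldType)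
    (charF : p \in [pchar F])
    (K : closedFieldType) (phi : {rmorphism 'F_p -> K}) (closureK : prime_field_closure phi)
    (iota : {rmorphism F -> K}) (a b : nat) :
  exists c, forall n (computable : {mpoly K[n]} -> nat -> Prop), cost_measure 16 computable ->
    forall (f : {mpoly F[n]}) r (fs : 'I_r -> {mpoly F[n]}) (e j : 'I_r -> nat),
      ((msize f).-1 <= a * n ^ a)%N ->
      computable (map_mpoly iota f) (2 * (b * n ^ (b * log2n n)))%N ->
      irreducible_factorization p f fs e j -> forall i,
      computable (map_mpoly iota (fs i ^+ (p ^ e i)))
        (c * (n ^ (num_values e * log2n n)) ^ c)%N.
Proof.
have [c leq_c] := factor_cost_leq a b.
exists c => n computable cost f r fs e j szf comp_f factorization i.
have s_gt0 : (0 < 2 * (b.+1 * n ^ (b * log2n n)))%N.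
  rewrite !muln_gt0 expn_gt0; case: (posnP n) => [->|//].
  by rewrite (_ : log2n 0 = 0%N) ?muln0.
have lt_D : (a * n ^ a < 2 ^ up_log 2 (a * n ^ a).+1)%N by apply: up_logP.
have comp_f' : computable (map_mpoly iota f) (2 * (b.+1 * n ^ (b * log2n n)))%N.
  by apply: (computable_leq cost _ comp_f); rewrite leq_mul2l leq_mul2r leqnSn orbT.
have num_gt0 : (0 < num_values e)%N by apply: leq_ltn_trans (values_below_num e i).
have num_leq := leq_trans (num_values_leq charF factorization) szf.
apply: (computable_leq cost _ (computable_irreducible_power charF factorization closureK
  cost i szf s_gt0 lt_D comp_f')).
exact: leq_c num_gt0 num_leq.
Qed.

Theorem theorem5p5 (p : nat) (p_prime : prime p)
    (F : fieldType) (charF : p \in [pchar F])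
    (K : closedFieldType) (phi : {rmorphism 'F_p -> K})
    (closureK : prime_field_closure phi)
    (iota : {rmorphism F -> K})
    (a b : nat) :
  (exists c : nat,
    forall (n : nat) (f : {mpoly F[n]})
           (r : nat) (fs : 'I_r -> {mpoly F[n]}) (e j : 'I_r -> nat),
      ((msize f).-1 <= a * n ^ a)%N ->
      formula_computable f (b * n ^ (b * log2n n)) ->
      irreducible_factorization p f fs e j ->
      forall i : 'I_r,
        formula_computable (map_mpoly iota (fs i ^+ (p ^ e i)))
          (c * (n ^ (num_values e * log2n n)) ^ c))
  /\
  (exists c : nat,
    forall (n : nat) (f : {mpoly F[n]})
           (r : nat) (fs : 'I_r -> {mpoly F[n]}) (e j : 'I_r -> nat),
      ((msize f).-1 <= a * n ^ a)%N ->
      abp_computable f (b * n ^ (b * log2n n)) ->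
      irreducible_factorization p f fs e j ->
      forall i : 'I_r,
        abp_computable (map_mpoly iota (fs i ^+ (p ^ e i)))
          (c * (n ^ (num_values e * log2n n)) ^ c)).
Proof.
have [c factor_bound] := computable_irreducible_power_bound charF closureK iota a b.
split; exists c => n f r fs e j szf comp_f factorization i.
  apply: factor_bound (formula_cost K n) _ _ _ _ _ szf _ factorization i.
  exact: formula_computable_map.
apply: factor_bound (abp_cost K n) _ _ _ _ _ szf _ factorization i.
apply: (computable_leq (abp_cost K n) _ (abp_computable_map iota comp_f)).
by rewrite leq_pmull.
Qed.
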